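(* For every ordered graph $F$ and every integer $n\ge 1$ there exists an $n$-conform ordered $F$-system $(H,\mathscr{H}_F)$ such that for every colouring $\phi\colon E(H)\to\mathbb{N}$ there is a copy $F_\star\in\mathscr{H}_F$ such that the restriction of $\phi$ to $E(F_\star)$ is canonical.
   Context: All graphs are finite and simple. An ordered graph is a graph together with a total order on its vertex set. For an ordered graph $F$, an ordered $F$-system is a pair $(B,\mathscr{B}_F)$ consisting of an ordered graph $B$ and a set $\mathscr{B}_F$ of induced subgraphs of $B$ isomorphic to $F$ by an order-preserving isomorphism (ordered induced copies of $F$). Two graphs $F,F'$ have a clean intersection if $|V(F)\cap V(F')|\le 1$ or $V(F)\cap V(F')\in E(F)\cap E(F')$. A family of graphs has clean intersections if any two distinct members have a clean intersection. $\omega$ denotes the clique number; $\mathrm{og}$ denotes the odd girth, i.e. the length of a shortest odd cycle, with $\mathrm{og}=\infty$ for bipartite graphs. A subgraph $F$ of $B$ is $n$-induced in $B$ if the following holds: whenever for two distinct vertices $x,y\in V(F)$ there is an $x$-$y$-path $P$ in $B$ which is not contained in $F$ and has length at most $n$, then the distance of $x$ and $y$ in $F$ is strictly smaller than the length of $P$. $\binom{B}{F}_n$ denotes the set of $n$-induced copies of $F$ in $B$. An ordered $F$-system $(B,\mathscr{B}_F)$ is $n$-conform if (i) the copies in $\mathscr{B}_F$ have clean intersections, (ii) $\omega(B)=\omega(F)$, (iii) $\mathrm{og}(B)\ge\min\{\mathrm{og}(F),2n+1\}$, and (iv) $\mathscr{B}_F\subseteq\binom{B}{F}_n$. A colouring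 $\phi\colon E(F)\to\mathbb{N}$ of an ordered graph $F$ is canonical if one of the following holds: all edges have the same colour; for all $e,e'\in E(F)$, $\phi(e)=\phi(e')\Leftrightarrow\min e=\min e'$; for all $e,e'\in E(F)$, $\phi(e)=\phi(e')\Leftrightarrow\max e=\max e'$; all edges have distinct colours. *)

(* Defs.v *)
From HB Require Import structures.
From mathcomp Require Import all_boot all_order.

Set Implicit Arguments.
Unset Strict Implicit.
Unset Printing Implicit Defensive.

(* A finite simple graph whose vertices are taken from a finite type T; edges
   are 2-element sets of vertices.  The vertex set need not be all of T, so that
   the subgraphs of a graph on T are again graphs on T. *)
Definition graph_axiom (T : finType) (G : {set T} * {set {set T}}) : bool :=
  [forall e in G.2, (#|e| == 2) && (e \subset G.1)].

Record graph (T : finType) := Graph {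
  graph_val : {set T} * {set {set T}};
  graph_valP : graph_axiom graph_val
}.

HB.instance Definition _ (T : finType) := [isSub of graph T for @graph_val T].
HB.instance Definition _ (T : finType) := [Countable of graph T by <:].
HB.instance Definition _ (T : finType) := [Finite of graph T by <:].

Definition verts (T : finType) (G : graph T) : {set T} := (graph_val G).1.
Definition edges (T : finType) (G : graph T) : {set {set T}} := (graph_val G).2.

Section Graphs.
Variable T : finType.
Implicit Types (F G B : graph T) (x y : T).

Definition adj G : rel T := fun x y => [set x; y] \in edges G.

Definition subgraph F B : bool :=
  (verts F \subset verts B) && (edges F \subset edges B).

Definition induced_subgraph F B : bool :=
  (verts F \subset verts B) &&
  (edges F == [set e in edges B | e \subset verts F]).

Definition clean_intersection F F' : bool :=
  (#|verts F :&: verts F'| <= 1) ||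
  (verts F :&: verts F' \in edges F :&: edges F').

Definition clique G (K : {set T}) : bool :=
  (K \subset verts G) &&
  [forall x in K, forall y in K, (x != y) ==> adj G x y].

Definition clique_number G : nat := \max_(K : {set T} | clique G K) #|K|.

(* The path visiting x and then the successive entries of p; its length
   (number of edges) is size p. *)
Definition is_path G x (p : seq T) : bool :=
  [&& x \in verts G, path (adj G) x p & uniq (x :: p)].

Definition is_path_between G x y (p : seq T) : bool :=
  is_path G x p && (last x p == y).

Definition is_cycle G (c : seq T) : bool :=
  (3 <= size c) && ucycleb (adj G) c.

End Graphs.

(* Extended natural numbers: None stands for infinity. *)
Definition enat := option nat.

Definition ele (a b : enat) : bool :=
  match a, b with
  | _, None => true
  | None, Some _ => false
  | Some m, Some n => m <= n
  end.

Definition elt (a b : enat) : bool := ~~ ele b a.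

Definition emin (a b : enat) : enat := if ele a b then a else b.

(* The least k <= N satisfying P, and infinity if there is none. *)
Definition least (N : nat) (P : pred nat) : enat :=
  ohead [seq k <- iota 0 N.+1 | P k].

(* Paths and cycles do not repeat vertices, so the bound #|verts G| on the
   lengths considered in the next two definitions is no restriction. *)
Definition odd_girth (T : finType) (G : graph T) : enat :=
  least #|verts G| (fun k => odd k && [exists c : k.-tuple T, is_cycle G c]).

Definition dist (T : finType) (G : graph T) (x y : T) : enat :=
  least #|verts G| (fun k => [exists p : k.-tuple T, is_path_between G x y p]).

Definition n_induced (n : nat) (T : finType) (F B : graph T) : Prop :=
  forall (x y : T) (p : seq T),
    x \in verts F -> y \in verts F -> x != y ->
    is_path_between B x y p -> ~~ is_path F x p -> size p <= n ->
    elt (dist F x y) (Some (size p)).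

(* An ordered graph is a graph on a finite totally ordered type, with the
   induced order on its vertex set. *)
Definition ordered_iso (d : Order.disp_t) (T : finOrderType d)
    (d' : Order.disp_t) (U : finOrderType d')
    (F : graph T) (F' : graph U) : Prop :=
  exists f : {x : T | x \in verts F} -> {y : U | y \in verts F'},
    [/\ bijective f,
        forall x y, (val (f x) <= val (f y))%O = (val x <= val y)%O
      & forall x y, adj F' (val (f x)) (val (f y)) = adj F (val x) (val y)].

Section Systems.
Variables (d : Order.disp_t) (T : finOrderType d).
Variables (d' : Order.disp_t) (U : finOrderType d').
Implicit Types (F : graph T) (B C : graph U) (S : {set graph U}).

Definition ordered_system F B S : Prop :=
  forall C, C \in S -> induced_subgraph C B /\ ordered_iso F C.

Definition n_induced_copy (n : nat) F B C : Prop :=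
  [/\ subgraph C B, ordered_iso F C & n_induced n C B].

Definition n_conform (n : nat) F B S : Prop :=
  [/\ {in S &, forall C C', C != C' -> clean_intersection C C'},
      clique_number B = clique_number F,
      ele (emin (odd_girth F) (Some (2 * n).+1)) (odd_girth B)
    & forall C, C \in S -> n_induced_copy n F B C].

End Systems.

(* Minimum and maximum of a set of vertices; None only for the empty set. *)
Definition set_min (d : Order.disp_t) (T : finOrderType d) (e : {set T}) :
  option T := [pick x in e | [forall y in e, (x <= y)%O]].

Definition set_max (d : Order.disp_t) (T : finOrderType d) (e : {set T}) :
  option T := [pick x in e | [forall y in e, (y <= x)%O]].

(* Colourings of the edges of F are represented by functions on all sets of
   vertices, of which only the values on edges F are used. *)
Definition canonical_colouring (d : Order.disp_t) (T : finOrderType d)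
    (F : graph T) (phi : {set T} -> nat) : Prop :=
  [\/ {in edges F &, forall e e', phi e = phi e'},
      {in edges F &, forall e e', phi e = phi e' <-> set_min e = set_min e'},
      {in edges F &, forall e e', phi e = phi e' <-> set_max e = set_max e'}
    | {in edges F &, injective phi}].

(* Main.v *)
Require Import Defs.
From HB Require Import structures.
From mathcomp Require Import all_boot all_order perm zify.

Set Implicit Arguments.
Unset Strict Implicit.
Unset Printing Implicit Defensive.

(** Partite construction, repeated [n.+1] times. The first base is a complete
    graph, which has the canonical Ramsey property by Erdos-Rado; each pass turns
    a base H with induced, k-induced copies of F into a system that is
    (k+1)-conform and still canonical.

    Over H one considers pictures: graphs with a homomorphism to H whose copies of
    F lie over copies of F in H. Pictures are amalgamated along the preimages of
    at most two vertices i, j of H. A path or cycle that is injective over H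
    crosses such a gluing in at most two vertices, and if these are nonadjacent
    then the part between them can be moved to another copy of the picture; hence
    conformity is preserved. Paths and cycles that are not injective over H are
    handled by the conformity of H.

    Starting from disjoint copies of F, four kinds of amalgamation are used. From
    the last one backwards, a colouring is regularised as follows: a finite
    colouring of the base edges is made constant over each ij (Hales-Jewett); the
    given colouring becomes, over each ij, constant, injective, or determined
    injectively by one end (canonical Hales-Jewett); at each vertex u the pattern
    of colours of the lines seen from u depends only on the line of u; and the
    palettes of different lines become disjoint unless forced otherwise. The
    colouring then descends to H, where a canonical copy of F is lifted. *)

(** * Ramsey and Hales-Jewett theorems *)

(** A colouring with unboundedly many colours cannot in general be made constant over every edge ij
    of the base. What can be achieved is that equality of colours over ij means agreement in a fixed
    subset of the two ends, the type of ij. To transfer canonicity from the base, all edges of the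
    copy found there should have one common type. Each pass therefore spends a finite colouring of
    its base on the types, and for this reason the Ramsey property is carried along with an
    auxiliary finite colouring that must become constant on the edges of the copy.

    Since the copies in a complete graph are not induced, the first pass gives no clean
    intersections, and the level 1 that it reaches holds for trivial reasons. Every later pass has a
    base with induced copies; it raises the level by one and produces clean intersections. At least
    one such pass is needed even for n = 1, which is why the level n+1 is reached. *)

Lemma pigeonhole_seq (T : Type) (C : finType) (f : T -> C) (n : nat) (s : seq T) :
  #|C| * n < size s -> exists c, n < count (fun x => f x == c) s.
Proof.
move=> lt_s; apply/existsP; apply: contraLR lt_s; rewrite negb_exists -leqNgt.
move=> /forallP small.
have -> : size s = \sum_c count (fun x => f x == c) s.
  elim: s {small} => [|x s IHs] /=; first by rewrite big1.
  rewrite big_split /= -IHs (bigD1 (f x)) //= eqxx big1 ?addn0 // => c.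
  by rewrite eq_sym => /negbTE ->.
rewrite -sum_nat_const; apply: leq_sum => c _.
by rewrite leqNgt small.
Qed.

(** Subsequences play the role of subsets, so that an increasing ground sequence stays increasing.
    One passes to a sequence on which the colour of a (k+1)-subsequence depends only on its first
    entry, and applies the pigeonhole principle to the first entries. *)
Lemma ramsey (k : nat) (C : finType) (m : nat) :
  exists N, forall (c : seq nat -> C) (l : seq nat), N <= size l ->
    exists s col, [/\ subseq s l, size s = m &
      forall t, subseq t s -> size t = k -> c t = col].
Proof.
elim: k m => [|k IHk] m.
  exists m => c l le_m; exists (take m l), (c [::]); split.
  - exact: take_subseq.
  - by rewrite size_takel.
  - by move=> [|].
have [N0 endhom] : exists N, forall (c : seq nat -> C) (l : seq nat), N <= size l ->
    exists s g, [/\ subseq s l, size s = (#|C| * m).+1 &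
      forall x t, subseq (x :: t) s -> size t = k -> c (x :: t) = g x].
  elim: (_.+1) => [|n [N1 IHn]].
    by exists 0 => c l _; exists [::], (fun x => c [::]); split; rewrite ?sub0seq.
  have [N2 ramN2] := IHk N1; exists N2.+1 => c [//|x l] /= leN.
  have [s1 [col [sub1 size1 hom1]]] := ramN2 (fun t => c (x :: t)) l leN.
  have [//|s2 [g [sub2 size2 hom2]]] := IHn c s1; first by rewrite size1.
  exists (x :: s2), (fun y => if y == x then col else g y); split.
  - by rewrite /= eqxx (subseq_trans sub2).
  - by rewrite /= size2.
  - move=> y t /=; case: eqP => [-> sub_t|_] size_t; last exact: hom2.
    by apply: hom1 => //; apply: subseq_trans sub2.
exists N0 => c l /(endhom c) [s [g [sub_s size_s hom_s]]].
have [|col lt_col] := @pigeonhole_seq _ _ g m s; first by rewrite size_s.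
set s' := filter (fun x => g x == col) s.
exists (take m s'), col; split.
- exact: subseq_trans (take_subseq _ _) (subseq_trans (filter_subseq _ _) sub_s).
- by rewrite size_takel // size_filter ltnW.
- move=> [|x t] // sub_t [size_t].
  have sub' : subseq (x :: t) s' by apply: subseq_trans sub_t (take_subseq _ _).
  rewrite (hom_s x t (subseq_trans sub' (filter_subseq _ _)) size_t).
  by have := mem_subseq sub' (mem_head x t); rewrite mem_filter => /andP[/eqP].
Qed.

Section HalesJewett.
Variable A : finType.

(** [None] is the variable of a word. A combinatorial line consists of the words [inst w a] for a
    fixed [w] containing [None]. *)
Definition inst (w : seq (option A)) (a : A) : seq A := map (odflt a) w.

Lemma inst_cat w1 w2 a : inst (w1 ++ w2) a = inst w1 a ++ inst w2 a.
Proof. exact: map_cat. Qed.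

Lemma inst_const f a : inst (map Some f) a = f.
Proof. by rewrite /inst -map_comp map_id_in. Qed.

Definition line_mono (C : eqType) (c : seq A -> C) (L : seq A) w :=
  None \in w /\ {in L &, forall a b, c (inst w a) = c (inst w b)}.

(* Colour focusing: if the common point f of the lines has the colour of one of
   them, then that line is monochromatic on x :: L. *)
Lemma hales_jewett_focus (L : seq A) (a0 x : A) :
  a0 \in L ->
  (forall C : finType, exists N, forall c : seq A -> C,
     exists2 w, size w = N & line_mono c L w) ->
  forall (C : finType) (s : nat), exists N, forall c : seq A -> C,
    (exists2 w, size w = N & line_mono c (x :: L) w) \/
    (exists ws f, [/\ size ws = s, size f = N,
       uniq [seq c (inst w a0) | w <- ws] &
       forall w, w \in ws -> [/\ size w = N, inst w x = f & line_mono c L w]]).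
Proof.
move=> La0 hjL C; elim=> [|s [N IHs]].
  by exists 0 => c; right; exists [::], [::].
(* A prefix is coloured by the function that it induces on all suffixes of length [N]; its line is
   then monochromatic whichever suffix follows. *)
have [N' hjN'] := hjL {ffun N.-tuple A -> C}; exists (N' + N) => c.
have [w' sizew' [w'N mono']] := hjN' (fun u => [ffun v : N.-tuple A => c (u ++ v)]).
have mono_w' a b v : a \in L -> b \in L -> size v = N ->
    c (inst w' a ++ v) = c (inst w' b ++ v).
  move=> La Lb /eqP sv; have /ffunP/(_ (Tuple sv)) := mono' a b La Lb.
  by rewrite !ffunE.
have lift_line L' w : size w = N -> line_mono (fun v => c (inst w' a0 ++ v)) L' w ->
    exists2 w1, size w1 = N' + N & line_mono c L' w1.
  move=> sw [wN monow]; exists (map Some (inst w' a0) ++ w).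
    by rewrite size_cat !size_map sizew' sw.
  split; first by rewrite mem_cat wN orbT.
  by move=> a b La Lb; rewrite !inst_cat !inst_const; apply: monow.
have [[w sw monow]|[ws [f [sws sf uws wsP]]]] := IHs (fun v => c (inst w' a0 ++ v)).
  by left; apply: lift_line sw monow.
have [/mapP[w ws_w cf]|cf] :=
    boolP (c (inst w' a0 ++ f) \in [seq c (inst w' a0 ++ inst w a0) | w <- ws]).
  left; have [sw wx [wN monow]] := wsP _ ws_w; apply: (lift_line _ w) => //; split=> // a b.
  have col d : d \in x :: L -> c (inst w' a0 ++ inst w d) = c (inst w' a0 ++ inst w a0).
    by rewrite inE => /predU1P[->|Ld]; [rewrite wx cf | apply: monow].
  by move=> La Lb; rewrite !col.
right; exists ((w' ++ map Some f) :: map (cat w') ws), (inst w' x ++ f); split.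
- by rewrite /= size_map sws.
- by rewrite size_cat size_map sizew' sf.
- rewrite /= inst_cat inst_const -map_comp (eq_map (g := fun w => c (inst w' a0 ++ inst w a0))).
    by rewrite cf.
  by move=> w /=; rewrite inst_cat.
- move=> w; rewrite inE => /predU1P[->|/mapP[w1 ws_w1 ->]].
    split; rewrite ?inst_cat ?inst_const ?size_cat ?size_map ?sizew' ?sf //.
    split; first by rewrite mem_cat w'N.
    by move=> a b La Lb; rewrite !inst_cat !inst_const; apply: mono_w'.
  have [sw wx [wN monow]] := wsP _ ws_w1.
  split; rewrite ?inst_cat ?wx ?size_cat ?sizew' ?sw //.
  split; first by rewrite mem_cat w'N.
  move=> a b La Lb; rewrite !inst_cat.
  rewrite (mono_w' a a0) ?size_map // (mono_w' b a0) ?size_map //.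
  exact: monow.
Qed.

Theorem hales_jewett (C : finType) :
  exists N, forall c : seq A -> C, exists w, [/\ size w = N, None \in w &
    forall a b, c (inst w a) = c (inst w b)].
Proof.
have [N hjN] : exists N, forall c : seq A -> C,
    exists2 w, size w = N & line_mono c (enum A) w.
  elim: (enum A) C => [|x L IHL] C.
    by exists 1 => c; exists [:: None].
  case: L IHL => [|a0 L] IHL.
    exists 1 => c; exists [:: None] => //; split=> // a b.
    by rewrite !inE => /eqP-> /eqP->.
  (* There are no [#|C|.+1] focused lines of distinct colours, so only the alternative of a
     monochromatic line remains. *)
  have [N focN] := hales_jewett_focus x (mem_head a0 L) IHL C #|C|.+1.
  exists N => c; have [//|[ws [f [sws _ uws _]]]] := focN c.
  by have := max_card (mem [seq c (inst w a0) | w <- ws]); rewrite (card_uniqP uws) size_map sws ltnn.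
exists N => c; have [w sw [wN monow]] := hjN c; exists w; split=> // a b.
by apply: monow; rewrite mem_enum.
Qed.

End HalesJewett.

(** * The canonical Hales-Jewett theorem *)

(** The passage from [p], [q] to [p'], [q'] changes only common values, in coordinates where the two
    points agree before and after. *)
Definition exchange (A : Type) (m : nat) (p q p' q' : nat -> A) :=
  forall s, s < m -> (p s = p' s /\ q s = q' s) \/ (p s = q s /\ p' s = q' s).

Definition interval_point (A : Type) (c : nat -> nat) (r : nat) (x : nat -> A) (s : nat) : A :=
  x (c s - (r < c s)).

(* Points that are constant on the intervals between consecutive boundaries:
   c s is the number of boundaries below s, and [interval_point r x] takes the
   value x k on the k-th interval when the r-th boundary is dropped. *)
Section IntervalPoints.
Variables (A : Type) (a0 : A) (t m : nat) (c : nat -> nat).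
Implicit Types (p q x y : nat -> A).
Variable e : (nat -> A) -> (nat -> A) -> Prop.
Local Notation Pt := (interval_point c).
Hypothesis e_refl : forall p, e p p.
Hypothesis e_sym : forall p q, e p q -> e q p.
Hypothesis e_trans : forall p q r, e p q -> e q r -> e p r.
Hypothesis e_eq : forall p q p' q', p =1 p' -> q =1 q' -> e p q -> e p' q'.
Hypothesis ins : forall p q p' q', e p q -> exchange m p q p' q' -> e p' q'.
Hypothesis hom : forall r r' x y, r < t.+2 -> r' < t.+2 -> e (Pt r x) (Pt r y) -> e (Pt r' x) (Pt r' y).
Hypothesis c_le : forall s, c s <= t.+2.

(** [near k] compares two letters on the interval [k] against the background [a0]. Its independence
    of the inner interval [k] is what yields a single relation on letters. *)
Let delta (k : nat) (a : A) (j : nat) := if j == k then a else a0.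
Let near k a b := e (Pt 0 (delta k a)) (Pt 0 (delta k b)).

(* Moving the right end of the last interval on which x and y differ changes the
   second point only. *)
Let last_near x y r : 0 < r <= t -> (forall k, r < k -> x k = y k) ->
    e (Pt t.+1 x) (Pt t.+1 y) -> near r (x r) (y r).
Proof.
move=> /andP[r_gt0 le_r] agree exy.
pose x' k := if k <= r then x k else x r; pose y' k := if k <= r then y k else x r.
have exy' : e (Pt t.+1 x') (Pt t.+1 y').
  apply: ins exy _ => s _; rewrite /Pt /x' /y'.
  by case: (leqP (_ - _) r) => [|/agree ->]; [left | right].
have exy'' : e (Pt r x') (Pt r y') by apply: hom exy'; lia.
have eyy : e (Pt t.+1 y') (Pt r y').
  apply: e_trans (e_sym exy') _; apply: e_eq exy'' => // s; rewrite /Pt /x'.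
  have le_c := c_le s; have [lt_rc|le_rc] : r < c s \/ c s <= r by lia.
    have -> : (c s - (t.+1 < c s) <= r) = false by lia.
    case: (leqP (c s - (r < c s)) r) => // le_c1.
    by have -> : c s - (r < c s) = r by lia.
  have -> : c s - (t.+1 < c s) = c s by lia.
  by have -> : c s - (r < c s) = c s by lia.
apply: ins eyy _ => s _; rewrite /Pt /y' /delta.
have le_c := c_le s.
have [cr|[cr|cr]] : c s <= r \/ r.+1 < c s \/ c s = r.+1 by lia.
- have -> : c s - (t.+1 < c s) = c s by lia.
  have -> : c s - (r < c s) = c s by lia.
  have -> : (c s - (0 < c s) == r) = false by lia.
  by right.
- have -> : (c s - (t.+1 < c s) <= r) = false by lia.
  have -> : (c s - (0 < c s) == r) = false by lia.
  have -> : (c s - (r < c s) <= r) = false by lia.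
  by right.
- have -> : (c s - (t.+1 < c s) <= r) = false by lia.
  have -> : (c s - (0 < c s) == r) = true by lia.
  have -> : c s - (r < c s) = r by lia.
  by left; rewrite leqnn.
Qed.

(** Dropping the first boundary instead of the last renumbers the interval [k.+1] as [k], while by
    [hom] it does not matter to [e] which boundary is dropped. *)
Let near_shift k a b : 0 < k < t -> near k a b <-> near k.+1 a b.
Proof.
move=> /andP[k_gt0 lt_k].
have ptE d s : Pt t.+1 (delta k.+1 d) s = Pt 0 (delta k d) s.
  rewrite /Pt /delta; have := c_le s => le_c.
  by rewrite (_ : (c s - (t.+1 < c s) == k.+1) = (c s - (0 < c s) == k)) //; lia.
split=> [nr|]; first by apply: (@hom t.+1) => //; apply: e_eq nr => s; rewrite ptE.
by move/(@hom 0 t.+1) => nr; apply: e_eq (nr _ _) => // s; rewrite ptE.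
Qed.

Let near1 k a b : 0 < k <= t -> near k a b <-> near 1 a b.
Proof.
elim: k => // -[|k] IH // le_k; rewrite -IH; last lia.
by apply: iff_sym; apply: near_shift; lia.
Qed.

Let subst_letter x y k : 0 < k <= t -> (forall j, j != k -> x j = y j) ->
    near 1 (x k) (y k) -> e (Pt t.+1 x) (Pt t.+1 y).
Proof.
move=> le_k agree /(near1 _ _ le_k) nr.
have {}nr : e (Pt t.+1 (delta k (x k))) (Pt t.+1 (delta k (y k))) by apply: hom nr.
apply: ins nr _ => s _; rewrite /Pt /delta.
by case: eqP => [->|/eqP/agree ->]; [left | right].
Qed.

(** Differences are peeled off from the right: [last_near] compares the letters on the last interval
    where the points may differ, after which [x] can take the letter of [y] there without leaving
    its class. Conversely, letters are replaced one at a time. *)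
Lemma interval_points_letterwise x y : x 0 = y 0 -> (forall k, t < k -> x k = y k) ->
    e (Pt t.+1 x) (Pt t.+1 y) <-> (forall k, 0 < k <= t -> near 1 (x k) (y k)).
Proof.
move=> xy0 agree; split.
  suff: forall r, r <= t -> (forall k, r < k -> x k = y k) -> e (Pt t.+1 x) (Pt t.+1 y) ->
    forall k, 0 < k <= t -> near 1 (x k) (y k) by move=> h; apply: (h t).
  move=> r; elim: r x xy0 agree => [|r IHr] x xy0 agree le_r tail exy k lek.
    by rewrite (tail k); [apply: e_refl | case/andP: lek].
  have nr : near r.+1 (x r.+1) (y r.+1) by apply: last_near => //.
  have nr1 := nr; rewrite near1 // in nr1.
  pose x1 j := if j == r.+1 then y j else x j.
  have [->//|ne_k] := eqVneq k r.+1.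
  suff: near 1 (x1 k) (y k) by rewrite /x1 (negbTE ne_k).
  apply: IHr => //; try lia.
  - by move=> j tj; rewrite /x1; case: eqP => // _; apply: agree.
  - move=> j rj; rewrite /x1; case: eqP => // /eqP ne_j; apply: tail; lia.
  - apply: e_trans exy; apply: (@subst_letter _ _ r.+1) => //.
      by move=> j /negbTE jr; rewrite /x1 jr.
    rewrite /x1 eqxx; move: nr1; rewrite /near => /e_sym //.
move=> all_near; pose z k j := if j <= k then y j else x j.
have ez k : k <= t -> e (Pt t.+1 x) (Pt t.+1 (z k)).
  elim: k => [_|k IHk le_k].
    by apply: e_eq (e_refl (Pt t.+1 x)) => // s; rewrite /Pt /z; case: (leqP (c s - _) 0) => //; rewrite leqn0 => /eqP->.
  apply: e_trans (IHk (ltnW le_k)) _; apply: (@subst_letter _ _ k.+1) => //.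
    by move=> j ne_j; rewrite /z; case: ifP; case: ifP => //; lia.
  by rewrite /z ltnn leqnn; apply: all_near.
apply: e_eq (ez t (leqnn t)) => // s; rewrite /Pt /z.
by case: (leqP (c s - _) t) => // /agree.
Qed.

End IntervalPoints.

Section CanonicalHalesJewett.
Variable A : finType.
Implicit Types (p q x y : nat -> A) (ws : seq (seq (option A))).

(** The points of the combinatorial subspace with blocks [ws]; only the first [size ws] values of
    [p] are read. *)
Fixpoint plug ws p : seq A :=
  if ws is w :: ws' then inst w (p 0) ++ plug ws' (fun s => p s.+1) else [::].

Lemma eq_plug ws p q : p =1 q -> plug ws p = plug ws q.
Proof. by elim: ws p q => //= w ws IH p q pq; rewrite pq (IH _ (fun s => q s.+1)). Qed.

(* Whether two points get the same colour depends only on the coordinates in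
   which they differ. *)
Lemma insensitive_blocks (m : nat) (I : finType) :
  exists N, forall phi : I -> seq A -> nat, exists ws,
    [/\ size ws = m, all (fun w => None \in w) ws,
        forall p, size (plug ws p) = N &
        forall i j p q p' q', exchange m p q p' q' ->
          phi i (plug ws p) = phi j (plug ws q) ->
          phi i (plug ws p') = phi j (plug ws q')].
Proof.
elim: m I => [|m IHm] I.
  by exists 0 => phi; exists [::].
(* The index [I * A] also records the letter of the first block, so that the later blocks are
   insensitive across different first letters. *)
have [N blocks] := IHm (I * A)%type.
(* The colour of a first block is the equality pattern of [phi] on all pairs of continuations. It
   takes finitely many values because the length [N] of the continuation is already fixed. *)
have [M hjM] := hales_jewett A {ffun (I * N.-tuple A) * (I * N.-tuple A) -> bool}.
exists (M + N) => phi.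
have [w [sw wN mono]] := hjM (fun u => [ffun z : (I * N.-tuple A) * (I * N.-tuple A) =>
  phi z.1.1 (u ++ z.1.2) == phi z.2.1 (u ++ z.2.2)]).
have [ws [sws allN size_ws ins]] := blocks (fun ia v => phi ia.1 (inst w ia.2 ++ v)).
exists (w :: ws); split=> [||p|i j p q p' q' ex] /=.
- by rewrite sws.
- by rewrite wN.
- by rewrite size_cat size_map sw size_ws.
have ex' : exchange m (fun s => p s.+1) (fun s => q s.+1) (fun s => p' s.+1) (fun s => q' s.+1).
  by move=> s lt_s; apply: (ex s.+1).
have [//|[p0 q0]|[pq0 pq0']] := ex 0.
  rewrite p0 q0; exact: (ins (i, p' 0) (j, q' 0)).
rewrite pq0 pq0' => /(ins (i, q 0) (j, q 0) _ _ _ _ ex') /= e.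
have [sp sq] := (size_ws (fun s => p' s.+1), size_ws (fun s => q' s.+1)).
have /ffunP/(_ ((i, tcast sp (in_tuple _)), (j, tcast sq (in_tuple _)))) := mono (q 0) (q' 0).
by rewrite !ffunE /= !val_tcast /= e eqxx => /esym/eqP.
Qed.

Section Template.
Variable I : finType.

Definition subst (p : I -> A) (o : A + I) : A :=
  match o with inl a => a | inr i => p i end.

(** A subspace of the subspace with blocks [ws]: the variable of block [s] is fixed to a letter or
    identified with a variable from [I], as [b s] prescribes. *)
Fixpoint template ws (b : nat -> A + I) : seq (A + I) :=
  if ws is w :: ws' then
    [seq if o is Some a then inl a else b 0 | o <- w] ++ template ws' (fun s => b s.+1)
  else [::].

Lemma map_template ws b (p : I -> A) :
  map (subst p) (template ws b) = plug ws (fun s => subst p (b s)).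
Proof.
elim: ws b => //= w ws IH b; rewrite map_cat IH; congr (_ ++ _).
by rewrite -map_comp; apply: eq_map => -[a|].
Qed.

Lemma mem_template ws b s :
  s < size ws -> all (fun w => None \in w) ws -> b s \in template ws b.
Proof.
elim: ws b s => [|w ws IH] b [|s] //= lt_s /andP[wN wsN]; rewrite mem_cat; apply/orP.
  by left; apply/mapP; exists None.
by right; apply: (IH (fun s => b s.+1)).
Qed.
End Template.

(** Blocks are merged into intervals. With [t = #|I|], Ramsey's theorem provides [t.+2] boundaries
    such that the equality pattern is the same whichever one is dropped. The word [W] drops the last
    one, has [a0] on the two outer intervals, and a variable on each of the [t] inner ones. *)
Theorem canonical_hales_jewett (a0 : A) (I : finType) :
  exists N, forall phi : seq A -> nat, exists (W : seq (A + I)) (E : rel A),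
    [/\ size W = N, forall i, inr i \in W &
      forall p q : I -> A, phi (map (subst p) W) = phi (map (subst q) W) <->
        (forall i, E (p i) (q i))].
Proof.
set t := #|I|.
have [m ramm] := ramsey t.+1 {ffun (t.+2).-tuple A * (t.+2).-tuple A -> bool} t.+2.
have [N blocks] := insensitive_blocks m unit.
exists N => phi.
have {blocks} [ws [sws allN size_ws ins]] := blocks (fun _ => phi).
pose e p q := phi (plug ws p) = phi (plug ws q).
have {}ins p q p' q' : e p q -> exchange m p q p' q' -> e p' q'.
  by move=> epq ex; apply: (ins tt tt) ex epq.
pose cnt (S : seq nat) s := count (fun b => b <= s) S.
(* A set [S] of [t.+1] boundaries is coloured by the equality pattern of all points that are
   constant between consecutive boundaries. *)
have [|L [col [subL sizeL homL]]] := ramm (fun S => [ffun z : (t.+2).-tuple A * (t.+2).-tuple A =>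
  phi (plug ws (fun s => nth a0 z.1 (cnt S s))) == phi (plug ws (fun s => nth a0 z.2 (cnt S s)))])
  (iota 0 m); first by rewrite size_iota.
have sortL : sorted ltn L by apply: subseq_sorted subL (iota_ltn_sorted 0 m); apply: ltn_trans.
pose l k := nth 0 L k; pose c := cnt L.
have cE k s : k < t.+2 -> (l k <= s) = (k < c s).
  rewrite -sizeL /l /c /cnt; elim: L sortL k {subL sizeL homL l c} => // b L IH /= pathL k lt_k.
  have sL := path_sorted pathL.
  have cnt0 : s < b -> count (fun b => b <= s) L = 0.
    move=> lt_sb; rewrite (eq_in_count (a2 := pred0)) ?count_pred0 // => z Lz /=.
    have := order_path_min ltn_trans pathL => /allP/(_ z Lz) lt_bz.
    by apply/negbTE; rewrite -ltnNge; apply: ltn_trans lt_bz.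
  case: k lt_k => [|k] lt_k /=; last rewrite (IH sL) //.
    by case: (leqP b s) => [_|/cnt0 ->].
  by case: (leqP b s) => [_|/cnt0 ->]; rewrite ?add1n ?ltnS.
have c_le s : c s <= t.+2 by rewrite -sizeL count_size.
pose del r := take r L ++ drop r.+1 L.
have cnt_del r s : r < t.+2 -> cnt (del r) s = c s - (r < c s).
  move=> lt_r; rewrite -(cE r) // /c /cnt.
  have {1}-> : L = take r L ++ l r :: drop r.+1 L.
    by rewrite -drop_nth ?sizeL // cat_take_drop.
  by rewrite /del !count_cat /=; lia.
pose Pt := @interval_point A c.
have hom r r' x y : r < t.+2 -> r' < t.+2 -> e (Pt r x) (Pt r y) -> e (Pt r' x) (Pt r' y).
  move=> lt_r lt_r'.
  pose X z : (t.+2).-tuple A := [tuple z (val i) | i < t.+2].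
  have plugE k z : k < t.+2 ->
      plug ws (fun s => nth a0 (X z) (cnt (del k) s)) = plug ws (Pt k z).
    move=> lt_k; apply: eq_plug => s; rewrite cnt_del //.
    have lt_c : c s - (k < c s) < t.+2 by have := c_le s; lia.
    by rewrite -[RHS](tnth_mktuple (fun i : 'I_t.+2 => z (val i)) (Ordinal lt_c)) (tnth_nth a0).
  have colE k : k < t.+2 ->
      col (X x, X y) = (phi (plug ws (Pt k x)) == phi (plug ws (Pt k y))).
    move=> lt_k; rewrite -(homL (del k)) ?ffunE /= ?plugE //.
      by rewrite -[X in subseq _ X](cat_take_drop k L) cat_subseq // -add1n -drop_drop drop_subseq.
    by rewrite size_cat size_drop size_takel sizeL; lia.
  by rewrite /e => /eqP; rewrite -colE // (colE r') // => /eqP.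
have e_sym p q : e p q -> e q p by move/esym.
have e_trans p q r : e p q -> e q r -> e p r by move=> e1 /(etrans e1).
have e_eq p q p' q' : p =1 p' -> q =1 q' -> e p q -> e p' q'.
  by rewrite /e => /eq_plug -> /eq_plug ->.
pose near k a b := e (Pt 0 (fun j => if j == k then a else a0)) (Pt 0 (fun j => if j == k then b else a0)).
have canon x y : x 0 = y 0 -> (forall k, t < k -> x k = y k) ->
    e (Pt t.+1 x) (Pt t.+1 y) <-> (forall k, 0 < k <= t -> near 1 (x k) (y k)).
  exact: (@interval_points_letterwise A a0 t m c e).
pose idx s := c s - (t.+1 < c s).
pose b s : A + I := nth (inl a0) (inl a0 :: map inr (enum I)) (idx s).
pose X (p : I -> A) k := nth a0 (a0 :: map p (enum I)) k.
have bE (p : I -> A) s : subst p (b s) = Pt t.+1 (X p) s.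
  rewrite /b /Pt /interval_point /X -/(idx s); case: (idx s) => //= k.
  have [lt_k|ge_k] := ltnP k #|I|; last by rewrite !nth_default // size_map -cardE.
  pose i0 := enum_val (Ordinal lt_k).
  have lt_k' : k < size (enum I) by rewrite -cardE.
  by rewrite (nth_map i0 _ inr lt_k') (nth_map i0 _ p lt_k').
pose letter a := Pt 0 (fun j => if j == 1 then a else a0).
exists (template ws b), (fun a a' => phi (plug ws (letter a)) == phi (plug ws (letter a'))).
split.
- by rewrite -(size_map (subst (fun=> a0))) map_template size_ws.
- move=> i; have lt_i : enum_rank i < t by [].
  have Lk : l (enum_rank i) \in L by rewrite /l mem_nth // sizeL; lia.
  have lt_s : l (enum_rank i) < m by have := mem_subseq subL Lk; rewrite mem_iota.
  have cl : c (l (enum_rank i)) = (enum_rank i).+1.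
    have h1 := cE (enum_rank i) (l (enum_rank i)).
    have h2 := cE (enum_rank i).+1 (l (enum_rank i)).
    have lt12 : l (enum_rank i) < l (enum_rank i).+1.
      by rewrite /l (sorted_ltn_nth ltn_trans 0 sortL) ?inE ?sizeL //; lia.
    by move: h1 h2; lia.
  have := @mem_template I ws b (l (enum_rank i)); rewrite sws => /(_ lt_s allN).
  have -> // : b (l (enum_rank i)) = inr i.
  have lt_i' : enum_rank i < size (enum I) by rewrite -cardE.
  rewrite /b /idx cl; have -> : (enum_rank i).+1 - (t.+1 < (enum_rank i).+1) = (enum_rank i).+1 by lia.
  by rewrite /= (nth_map i _ _ lt_i') nth_enum_rank.
- move=> p q; rewrite !map_template (eq_plug _ (bE p)) (eq_plug _ (bE q)).
  apply: iff_trans (canon (X p) (X q) _ _) _ => //.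
    by move=> k lt_k; rewrite /X !nth_default //= size_map -cardE.
  split=> [h i|h [|k] // /andP[_ lt_k]].
    have /h : 0 < (enum_rank i).+1 <= t by rewrite ltn_ord.
    have lt_i : enum_rank i < size (enum I) by rewrite -cardE.
    by rewrite /X /= !(nth_map i _ _ lt_i) nth_enum_rank => ->.
  have lt_k' : k < size (enum I) by rewrite -cardE.
  have := h (enum_val (Ordinal lt_k)); rewrite (enum_val_nth (enum_val (Ordinal lt_k))).
  by rewrite /X /= !(nth_map (enum_val (Ordinal lt_k)) _ _ lt_k') => /eqP.
Qed.

End CanonicalHalesJewett.

(** * The Erdos-Rado theorem *)

Definition canonical_pattern (m : nat) (F : rel 'I_m) (k : 'I_m -> 'I_m -> nat) : Prop :=
  let edges_all R := forall i j i' j' : 'I_m, i < j -> i' < j' -> F i j -> F i' j' ->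
    R (k i j = k i' j') i j i' j' in
  [\/ edges_all (fun same _ _ _ _ => same),
      edges_all (fun same i _ i' _ => same <-> i = i'),
      edges_all (fun same _ j _ j' => same <-> j = j')
    | edges_all (fun same i j i' j' => same -> i = i' /\ j = j')].

Lemma subseq_nth_sorted (s : seq nat) (t : seq nat) :
  sorted ltn t -> all (fun i => i < size s) t -> subseq [seq nth 0 s i | i <- t] s.
Proof.
move=> st /allP t_s; rewrite -{2}(mkseq_nth 0 s); apply: map_subseq.
have -> : t = [seq i <- iota 0 (size s) | i \in t].
  apply: (irr_sorted_eq ltn_trans ltnn) => // [|i].
    by apply: sorted_filter (iota_ltn_sorted _ _); apply: ltn_trans.
  rewrite mem_filter mem_iota; case it: (i \in t) => //=.
  by rewrite (t_s i it).
exact: filter_subseq.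
Qed.

(* The proof moves the largest or the smallest vertex of two equally coloured
   edges within a set that is homogeneous for the colour patterns of 4-sets. *)
Theorem erdos_rado (m : nat) (F : rel 'I_m) (C : finType) :
  exists N, forall (phi : 'I_N -> 'I_N -> nat) (tau : 'I_N -> 'I_N -> C),
    exists c : 'I_m -> 'I_N,
      [/\ forall i j : 'I_m, i < j -> c i < c j,
          canonical_pattern F (fun i j => phi (c i) (c j)) &
          forall i j i' j' : 'I_m, i < j -> i' < j' -> tau (c i) (c j) = tau (c i') (c j')].
Proof.
(* Of the [m.+3] points, those with indices 1 to [m] will carry the copy; index 0 below and the two
   indices above leave room for moving an end of an edge. *)
have [N4 ram4] := ramsey 4 {ffun ('I_4 * 'I_4) * ('I_4 * 'I_4) -> bool} m.+3.
have [N ram2] := ramsey 2 (option C) N4.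
exists N => phi tau.
pose phiN x y := if (insub x, insub y) is (Some a, Some b) then phi a b else 0.
pose tauN x y := if (insub x, insub y) is (Some a, Some b) then Some (tau a b) else None.
have [|L [colt [subL sizeL homL]]] :=
  ram2 (fun S => tauN (nth 0 S 0) (nth 0 S 1)) (iota 0 N); first by rewrite size_iota.
pose pat (S : seq nat) := [ffun z : ('I_4 * 'I_4) * ('I_4 * 'I_4) =>
  phiN (nth 0 S z.1.1) (nth 0 S z.1.2) == phiN (nth 0 S z.2.1) (nth 0 S z.2.2)].
have [|s [col [sub_s size_s hom_s]]] := ram4 pat L; first by rewrite sizeL.
pose u := nth 0 s.
have sort_s : sorted ltn s.
  apply: subseq_sorted ltn_trans _ _ (subseq_trans sub_s subL) _.
  exact: iota_ltn_sorted.
have u_lt i j : i < j -> j < m.+3 -> u i < u j.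
  by move=> ij jm; rewrite (sorted_ltn_nth ltn_trans 0 sort_s) ?inE ?size_s //; lia.
have u_N i : i < m.+3 -> u i < N.
  move=> im; have: u i \in iota 0 N.
    by apply: (mem_subseq (subseq_trans sub_s subL)); rewrite mem_nth // size_s.
  by rewrite mem_iota.
pose E i j k l := phiN (u i) (u j) = phiN (u k) (u l).
have patE p q r t a0 a1 a2 a3 : p < 4 -> q < 4 -> r < 4 -> t < 4 ->
    a0 < a1 -> a1 < a2 -> a2 < a3 -> a3 < m.+3 ->
    E (nth 0 [:: a0; a1; a2; a3] p) (nth 0 [:: a0; a1; a2; a3] q)
      (nth 0 [:: a0; a1; a2; a3] r) (nth 0 [:: a0; a1; a2; a3] t) <->
    col (inord p, inord q, (inord r, inord t)).
  move=> p4 q4 r4 t4 a01 a12 a23 a3m; set a := [:: a0; a1; a2; a3].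
  rewrite -(hom_s [seq u i | i <- a]) //; last first.
    by apply: subseq_nth_sorted; rewrite /= ?size_s; lia.
  rewrite ffunE /= !inordK // /E.
  have nthE k : k < 4 -> nth 0 [seq u i | i <- a] k = u (nth 0 a k).
    by move=> k4; rewrite (nth_map 0).
  by rewrite -/a -!nthE //; split=> /eqP.
have hom4 p q r t a0 a1 a2 a3 b0 b1 b2 b3 :
    E (nth 0 [:: a0; a1; a2; a3] p) (nth 0 [:: a0; a1; a2; a3] q)
      (nth 0 [:: a0; a1; a2; a3] r) (nth 0 [:: a0; a1; a2; a3] t) ->
    all (fun k => k < 4) [:: p; q; r; t] ->
    [&& a0 < a1, a1 < a2, a2 < a3 & a3 < m.+3] ->
    [&& b0 < b1, b1 < b2, b2 < b3 & b3 < m.+3] ->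
    E (nth 0 [:: b0; b1; b2; b3] p) (nth 0 [:: b0; b1; b2; b3] q)
      (nth 0 [:: b0; b1; b2; b3] r) (nth 0 [:: b0; b1; b2; b3] t).
  by move=> e /and5P[? ? ? ? _] /and4P[? ? ? ?] /and4P[? ? ? ?]; apply/patE => //; move: e; rewrite patE.
(* [L0]: two edges with the same minimum have the same colour; [U0]: two edges with the same maximum
   do. Homogeneity extends the single instance to all. *)
pose L0 := E 0 1 0 2; pose U0 := E 0 2 1 2.
have Lall i j k : L0 -> i < j -> j < k -> k < m.+2 -> E i j i k.
  move=> l0 ij jk km; apply: (hom4 0 1 0 2 0 1 2 3 i j k m.+2) => //=; lia.
have Uall i j k : U0 -> i < j -> j < k -> k < m.+2 -> E i k j k.
  move=> l0 ij jk km; apply: (hom4 0 2 1 2 0 1 2 3 i j k m.+2) => //=; lia.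
(* Moving the larger maximum [l] up to [m.+1] preserves the pattern, so the edges from [k] to [l]
   and from [k] to [m.+1] have the same colour. *)
have maxL i j k l : 0 < i -> i < j -> 0 < k -> k < l -> j < l -> l < m.+1 -> E i j k l -> L0.
  move=> i0 ij k0 kl jl lm e.
  suff e': E i j k m.+1.
    have {e'}e : E k l k m.+1 by rewrite /E -e'.
    apply: (hom4 0 1 0 2 k l m.+1 m.+2 0 1 2 3) => //=; lia.
  have [ki|[ki|[[ik kj]|[kj|jk]]]] : k < i \/ k = i \/ (i < k /\ k < j) \/ k = j \/ j < k by lia.
  - apply: (hom4 1 2 0 3 k i j l k i j m.+1) => //=; lia.
  - rewrite ki in e *; apply: (hom4 0 1 0 2 i j l m.+2 i j m.+1 m.+2) => //=; lia.
  - apply: (hom4 0 2 1 3 i k j l i k j m.+1) => //=; lia.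
  - rewrite kj in e *; apply: (hom4 0 1 1 2 i j l m.+2 i j m.+1 m.+2) => //=; lia.
  - apply: (hom4 0 1 2 3 i j k l i j k m.+1) => //=; lia.
(* Dually, the smaller minimum [i] is moved down to 0. *)
have minU i j k l : 0 < i -> i < j -> 0 < k -> k < l -> i < k -> j < m.+1 -> l < m.+1 ->
    E i j k l -> U0.
  move=> i0 ij k0 kl ik jm lm e.
  suff e': E 0 j k l.
    have {e'}e : E 0 j i j by rewrite /E e e'.
    apply: (hom4 0 2 1 2 0 i j m.+2 0 1 2 3) => //=; lia.
  have [jk|[jk|[[kj jl]|[jl|lj]]]] : j < k \/ j = k \/ (k < j /\ j < l) \/ j = l \/ l < j by lia.
  - apply: (hom4 0 1 2 3 i j k l 0 j k l) => //=; lia.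
  - rewrite jk in e *; apply: (hom4 0 1 1 2 i k l m.+2 0 k l m.+2) => //=; lia.
  - apply: (hom4 0 2 1 3 i k j l 0 k j l) => //=; lia.
  - rewrite jl in e *; apply: (hom4 0 2 1 2 i k l m.+2 0 k l m.+2) => //=; lia.
  - apply: (hom4 0 3 1 2 i k l j 0 k l j) => //=; lia.
have cP (i : 'I_m) : u i.+1 < N by apply: u_N; have := ltn_ord i; lia.
pose c i := Ordinal (cP i); exists c.
have phiE i j : phi (c i) (c j) = phiN (u i.+1) (u j.+1).
  by rewrite /phiN !(insubT (fun x => x < N) (cP _)).
have EE i j i' j' : (phi (c i) (c j) = phi (c i') (c j')) <-> E i.+1 j.+1 i'.+1 j'.+1.
  by rewrite !phiE.
have maxL' (i j i' j' : 'I_m) : i < j -> i' < j' -> j != j' -> phi (c i) (c j) = phi (c i') (c j') -> L0.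
  move=> ij ij' jj /EE e; have [? ?] := (ltn_ord j, ltn_ord j').
  have [lt_j|lt_j] : j < j' \/ j' < j by move: jj; rewrite -val_eqE /=; lia.
    by apply: maxL e.
  by apply: maxL (esym e).
have minU' (i j i' j' : 'I_m) : i < j -> i' < j' -> i != i' -> phi (c i) (c j) = phi (c i') (c j') -> U0.
  move=> ij ij' jj /EE e; have [? ?] := (ltn_ord j, ltn_ord j').
  have [lt_i|lt_i] : i < i' \/ i' < i by move: jj; rewrite -val_eqE /=; lia.
    by apply: minU e.
  by apply: minU (esym e).
have Lall' (i j j' : 'I_m) : L0 -> i < j -> i < j' -> phi (c i) (c j) = phi (c i) (c j').
  move=> l0 ij ij'; apply/EE; have [? ?] := (ltn_ord j, ltn_ord j').
  have [lt_j|[lt_j|->//]] : j < j' \/ j' < j \/ nat_of_ord j = j' by lia.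
    by apply: Lall => //; lia.
  by apply/esym; apply: Lall => //; lia.
have Uall' (i i' j : 'I_m) : U0 -> i < j -> i' < j -> phi (c i) (c j) = phi (c i') (c j).
  move=> l0 ij ij'; apply/EE; have ? := ltn_ord j.
  have [lt_j|[lt_j|->//]] : i < i' \/ i' < i \/ nat_of_ord i = i' by lia.
    by apply: Uall => //; lia.
  by apply/esym; apply: Uall => //; lia.
split.
- by move=> i j ij; apply: u_lt => //; have := ltn_ord j; lia.
- have [l0|nl0] := eqVneq (phiN (u 0) (u 1)) (phiN (u 0) (u 2));
    have [u0|nu0] := eqVneq (phiN (u 0) (u 2)) (phiN (u 1) (u 2)).
  + constructor 1 => i j i' j' ij ij' _ _; apply/EE.
    have [? ?] := (ltn_ord j, ltn_ord j').
    have top (k l : 'I_m) : k < l -> E k.+1 l.+1 k.+1 m.+1.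
      by move=> kl; apply: Lall => //; have := ltn_ord l.
    rewrite /E (top i j) // (top i' j') //.
    have [lt_i|[lt_i|->//]] : i < i' \/ i' < i \/ nat_of_ord i = i' by lia.
      apply: Uall => //; lia.
    apply/esym; apply: Uall => //; lia.
  + constructor 2 => i j i' j' ij ij' _ _; split=> [e|ii].
      by apply/eqP; apply: contraNT nu0 => ii; apply/eqP; apply: minU' e.
    by rewrite -ii in ij' *; apply: Lall'.
  + constructor 3 => i j i' j' ij ij' _ _; split=> [e|ii].
      by apply/eqP; apply: contraNT nl0 => ii; apply/eqP; apply: maxL' e.
    by rewrite -ii in ij' *; apply: Uall'.
  + constructor 4 => i j i' j' ij ij' _ _ e; split; apply/eqP.
      by apply: contraNT nu0 => ii; apply/eqP; apply: minU' e.
    by apply: contraNT nl0 => ii; apply/eqP; apply: maxL' e.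
- have tauE (i j : 'I_m) : i < j -> Some (tau (c i) (c j)) = colt.
    move=> ij; have -> : Some (tau (c i) (c j)) = tauN (u i.+1) (u j.+1).
      by rewrite /tauN !(insubT (fun x => x < N) (cP _)).
    apply: (homL [:: u i.+1; u j.+1]) => //; apply: subseq_trans sub_s.
    apply: (subseq_nth_sorted (t := [:: i.+1; j.+1])); rewrite /= ?ltnS ?ij //.
    by rewrite size_s; have [] := (ltn_ord i, ltn_ord j); lia.
  by move=> i j i' j' ij ij'; apply: Some_inj; rewrite !tauE.
Qed.

(** * Pictures and their amalgamation *)

Lemma not_uniq_split (T : eqType) (s : seq T) :
  ~~ uniq s -> exists x s1 s2 s3, s = s1 ++ x :: s2 ++ x :: s3.
Proof.
elim: s => //= y s IHs; rewrite negb_and negbK => /orP[|/IHs[x [s1 [s2 [s3 ->]]]]].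
  by case/splitPr => s2 s3; exists y, [::], s2, s3.
by exists x, (y :: s1), s2, s3.
Qed.

(** Cutting at a repeated vertex leaves an odd and a nonempty even closed walk. The even one has
    length at least 2, which is exactly the amount by which the bound on odd walks grows in one
    pass. *)
Lemma odd_cycle_split (T : eqType) (e : rel T) (s : seq T) :
  cycle e s -> odd (size s) -> ~~ uniq s ->
  exists s', [/\ cycle e s', odd (size s') & size s' + 2 <= size s].
Proof.
move=> + + /not_uniq_split[x [s1 [s2 [s3 es]]]].
rewrite -(rot_cycle (size s1) e) -(size_rot (size s1) s).
have {es}-> : rot (size s1) s = (x :: s2 ++ x :: s3) ++ s1 by rewrite es rot_size_cat.
rewrite /=.
rewrite -catA /= rcons_cat cat_path /= rcons_cat => /and3P[p2 px p3].
rewrite !size_cat /= size_cat => sz.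
have [od|ev] := boolP (odd (size s2)).
  by exists (x :: (s3 ++ s1)); rewrite /= rcons_cat size_cat; split=> //; move: od sz; lia.
by exists (x :: s2); rewrite /= rcons_path p2 px; split=> //; move: ev sz; lia.
Qed.

Lemma has_split (T : Type) (p : pred T) (s : seq T) :
  has p s -> exists s1 x s2, [/\ s = s1 ++ x :: s2, p x & all (predC p) s1].
Proof.
elim: s => //= y s IHs; have [py _|npy /IHs[s1 [x [s2 [-> px ps1]]]]] := boolP (p y).
  by exists [::], y, s.
by exists (y :: s1), x, s2; rewrite /= npy.
Qed.

Section Conformity.
Variables (m : nat) (F : rel 'I_m) (V : finType) (adj : rel V) (cop : {set {ffun 'I_m -> V}}).

Definition copies_induced := forall c, c \in cop -> forall i j, adj (c i) (c j) = F i j.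

(* n-inducedness in terms of walks: every walk contains a path, and a walk that
   is not a path is longer than some path between its ends. *)
Definition copies_near_induced (n : nat) := forall c, c \in cop -> forall i j s,
  path adj (c i) s -> last (c i) s = c j -> size s <= n ->
  (exists s', [/\ path F i s', last i s' = j & size s' < size s]) \/
  (exists s', path F i s' /\ s = map c s').

Definition odd_walks_bounded (n : nat) := forall s,
  cycle adj s -> odd (size s) -> size s <= n ->
  exists s', [/\ cycle F s', odd (size s') & size s' <= size s].

Definition cliques_bounded (w : nat) := forall s, pairwise adj s -> size s <= w.

Definition copies_clean := forall c c', c \in cop -> c' \in cop -> c != c' ->
  forall i j k l, i != k -> c i = c' j -> c k = c' l ->
  F i k /\ forall p q, c p = c' q -> p = i \/ p = k.
End Conformity.

Section Pictures.
Variables (m : nat) (F : rel 'I_m) (w n : nat).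
Variables (W : finType) (hadj : rel W) (hcop : {set {ffun 'I_m -> W}}).
Hypothesis w_gt1 : 1 < w.
Hypothesis hadj_sym : symmetric hadj.
Hypothesis hadj_irr : irreflexive hadj.
Hypothesis hcop_inj : forall c, c \in hcop -> injective c.

(* Not assumed outright, as the copies of F in the first base, a complete graph,
   are not induced. *)
Definition base_conform :=
  [/\ copies_induced F hadj hcop, copies_near_induced F hadj hcop n &
      odd_walks_bounded F hadj n.*2].

Record picture := Picture {
  pvert : finType;
  padj : rel pvert;
  proj : pvert -> W;
  pcop : {set {ffun 'I_m -> pvert}};
  padj_sym : symmetric padj;
  padj_hom : forall u v, padj u v -> hadj (proj u) (proj v);
  pcop_proj : forall c, c \in pcop -> [ffun i => proj (c i)] \in hcop;
  pcop_ind : copies_induced F padj pcop;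
  p_cliques : cliques_bounded padj w;
  p_conform : base_conform ->
    [/\ copies_clean F pcop, copies_near_induced F padj pcop n.+1 &
        odd_walks_bounded F padj n.+1.*2]
}.

Definition embedding (P Q : picture) (e : pvert P -> pvert Q) :=
  [/\ injective e,
      forall u, proj (e u) = proj u,
      forall u v, padj u v -> padj (e u) (e v) &
      forall c, c \in pcop P -> [ffun i => e (c i)] \in pcop Q].

(** * Amalgamation over a vertex or an edge of the base *)

Section Amalgam.
Variables (P : picture) (i0 j0 : W) (Z L : finType) (zproj : Z -> W) (lam : L -> pvert P -> Z).
Let V := pvert P.
Let over (x : W) := (x == i0) || (x == j0).
Hypothesis adj_ij : i0 != j0 -> hadj i0 j0.
Hypothesis zproj_over : forall z, over (zproj z).
Hypothesis lam_proj : forall l u, over (proj u) -> zproj (lam l u) = proj u.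
Hypothesis lam_inj : forall l u v, over (proj u) -> over (proj v) -> lam l u = lam l v -> u = v.
(* Weaker than clean intersections, but satisfied by products of bipartite graphs
   and sufficient, since copies of F over ij are induced. *)
Hypothesis lam_share : forall l l' u v u' v',
  over (proj u) -> over (proj v) -> over (proj u') -> over (proj v') ->
  proj u != proj v -> lam l u = lam l' u' -> lam l v = lam l' v' -> ~~ padj u v ->
  u = u' /\ v = v'.

(** [Z] is the part over [i0] and [j0], common to all copies of [P]; [L] indexes the copies, and
    [lam l] attaches the copy [l] to [Z]. Pairs [(l, u)] with [u] over [i0] or [j0] remain as
    isolated vertices. The case [i0 = j0] is gluing over a single vertex. *)
Let Q := (Z + L * V)%type.
Let iota (l : L) (u : V) : Q := if over (proj u) then inl (lam l u) else inr (l, u).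
Let qproj (q : Q) : W := match q with inl z => zproj z | inr lu => proj lu.2 end.
Let qadj (q q' : Q) :=
  [exists t : L * (V * V), [&& padj t.2.1 t.2.2, q == iota t.1 t.2.1 & q' == iota t.1 t.2.2]].
Let qcop : {set {ffun 'I_m -> Q}} :=
  [set [ffun i => iota t.1 (t.2 i)] |
     t : L * {ffun 'I_m -> V} in [set t | t.2 \in pcop P]].
Let qover q := over (qproj q).

Let iota_proj l u : qproj (iota l u) = proj u.
Proof. by rewrite /iota; case: ifP => //= /lam_proj ->. Qed.

Let iota_eq l u l' u' : iota l u = iota l' u' ->
  (l = l' /\ u = u') \/ [/\ over (proj u), over (proj u') & lam l u = lam l' u'].
Proof. by rewrite /iota; do 2![case: ifP] => // o o' [] *; [right | left]. Qed.

Let iota_out l u l' u' : ~~ over (proj u) -> iota l u = iota l' u' -> l = l' /\ u = u'.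
Proof. by move=> /negP out /iota_eq[//|[]]. Qed.

Let iota_inj l : injective (iota l).
Proof. by move=> u v /iota_eq[[]|[]] // ou ov; apply: lam_inj. Qed.

Let qadjP q q' :
  reflect (exists l u v, [/\ padj u v, q = iota l u & q' = iota l v]) (qadj q q').
Proof.
apply: (iffP existsP) => [[[l [u v]] /= /and3P[? /eqP-> /eqP->]]|[l [u [v [? -> ->]]]]].
  by exists l, u, v.
by exists (l, (u, v)); rewrite !eqxx !andbT.
Qed.

Let qadj_sym : symmetric qadj.
Proof.
by move=> q q'; apply/qadjP/qadjP => -[l [u [v [? ? ?]]]]; exists l, v, u; rewrite padj_sym.
Qed.

Let qadj_hom q q' : qadj q q' -> hadj (qproj q) (qproj q').
Proof. by case/qadjP => l [u [v [uv -> ->]]]; rewrite !iota_proj padj_hom. Qed.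

Let iota_share l l' u v u' v' : proj u != proj v -> over (proj u) -> over (proj v) ->
  iota l u = iota l' u' -> iota l v = iota l' v' -> ~~ padj u v -> u = u' /\ v = v'.
Proof.
move=> uv ou ov /iota_eq[[<- <-]|[_ ou' lu]] /iota_eq[[e1 <-]|[_ ov' lv]] // nuv.
- by split=> //; apply: lam_inj lv.
- by split=> //; move: lu; rewrite -e1; apply: lam_inj.
- exact: (lam_share ou ov ou' ov' uv lu lv nuv).
Qed.

(** An edge contributed by another copy between two glued vertices is already an edge of this copy:
    if it were not, [lam_share] would identify the two pairs of preimages. *)
Let qadj_iota l u v : qadj (iota l u) (iota l v) = padj u v.
Proof.
apply/qadjP/idP => [[l' [u' [v' [uv' eu ev]]]]|uv]; last by exists l, u, v.
have [ou|/iota_out/(_ eu)[ll uu]] := boolP (over (proj u)); last first.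
  by rewrite uu; have -> // : v = v'; apply: (@iota_inj l); rewrite ev ll.
have [ov|/iota_out/(_ ev)[ll vv]] := boolP (over (proj v)); last first.
  by rewrite vv; have -> // : u = u'; apply: (@iota_inj l); rewrite eu ll.
apply: contraLR (uv') => nuv.
have [|<- <- //] := iota_share _ ou ov eu ev nuv.
have := padj_hom uv'; rewrite -(iota_proj l' u') -(iota_proj l' v') -eu -ev !iota_proj.
by apply: contraTneq => ->; rewrite hadj_irr.
Qed.

Let qcopP c : reflect (exists l c0, c0 \in pcop P /\ c = [ffun i => iota l (c0 i)]) (c \in qcop).
Proof.
apply: (iffP imsetP) => [[[l c0]]|[l [c0 [c0P ->]]]].
  by rewrite inE /= => c0P ->; exists l, c0.
by exists (l, c0); rewrite ?inE.
Qed.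

Let proj_inj c i j : c \in pcop P -> proj (c i) = proj (c j) -> i = j.
Proof. by move=> /pcop_proj/hcop_inj inj e; apply: inj; rewrite !ffunE. Qed.

Let over_cases x y z : over x -> over y -> over z -> x != y -> z = x \/ z = y.
Proof.
move=> /orP[]/eqP-> /orP[]/eqP-> /orP[]/eqP->; rewrite ?eqxx //; by [left | right].
Qed.

Let over_adj x y : over x -> over y -> x != y -> hadj x y.
Proof.
move=> /orP[]/eqP-> /orP[]/eqP->; rewrite ?eqxx // => ne.
by rewrite hadj_sym adj_ij // eq_sym.
Qed.

Let qcop_proj c : c \in qcop -> [ffun i => qproj (c i)] \in hcop.
Proof.
case/qcopP => l [c0 [/pcop_proj c0P ->]].
suff -> : [ffun i => qproj ([ffun i => iota l (c0 i)] i)] = [ffun i => proj (c0 i)] by [].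
by apply/ffunP => i; rewrite !ffunE iota_proj.
Qed.

Let qcop_ind : copies_induced F qadj qcop.
Proof. by move=> _ /qcopP[l [c [/pcop_ind cP ->]]] i j; rewrite !ffunE qadj_iota. Qed.

(** A clique with a vertex off the glued part lies in one copy of [P]. Over [i0] and [j0] alone it
    has at most two vertices, since adjacent vertices have distinct projections. *)
Let q_cliques : cliques_bounded qadj w.
Proof.
move=> s ps.
have adj_in x y : x \in s -> y \in s -> x = y \/ qadj x y.
  elim: s ps => //= z s IHs /andP[/allP zs ps]; rewrite !inE.
  move=> /predU1P[->|xs] /predU1P[->|ys]; [by left | by right; apply: zs | | exact: IHs].
  by right; rewrite qadj_sym; apply: zs.
have [all_over|] := boolP (all qover s).
  have us : uniq (map qproj s).
    elim: s ps {adj_in all_over} => //= z s IHs /andP[/allP zs ps]; rewrite IHs // andbT.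
    by apply/mapP => -[y /zs/qadj_hom + e]; rewrite e hadj_irr.
  have sub : {subset map qproj s <= [:: i0; j0]}.
    by move=> _ /mapP[q /(allP all_over) oq ->]; rewrite !inE.
  by have := uniq_leq_size us sub; rewrite size_map => /leq_trans; apply.
case/allPn => -[z|[l u]] qs; first by rewrite /qover zproj_over.
rewrite /qover /= => ou.
have qE : inr (l, u) = iota l u by rewrite /iota (negbTE ou).
have in_l x : x \in s -> exists v, x = iota l v.
  move=> xs; have [<-|] := adj_in _ _ qs xs; first by exists u.
  rewrite qE => /qadjP[l' [u' [v [_ /(iota_out ou)[<- _] ->]]]]; by exists v.
have [s0 es] : exists s0, s = map (iota l) s0.
  elim: s in_l {ps adj_in qs} => [|x s IHs] in_l; first by exists [::].
  have [v ->] := in_l x (mem_head x s).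
  have [|s0 ->] := IHs; first by move=> y ys; apply: in_l; rewrite inE ys orbT.
  by exists (v :: s0).
rewrite es size_map; apply: (@p_cliques P); move: ps; rewrite es pairwise_map.
by apply: sub_pairwise => x y /=; rewrite qadj_iota.
Qed.

Let segment x s y : path qadj x (rcons s y) -> all (fun q => ~~ qover q) s ->
  exists l x0 s0 y0, [/\ x = iota l x0, s = map (iota l) s0, y = iota l y0 &
    path (@padj P) x0 (rcons s0 y0)].
Proof.
elim: s x => [|z s IHs] x /=.
  by rewrite andbT => /qadjP[l [u [v [uv -> ->]]]] _; exists l, u, [::], v; rewrite /= uv.
move=> /andP[/qadjP[l [u [v [uv -> ez]]]] pz] /andP[oz /(IHs _ pz)].
case=> l' [z0 [s0 [y0 [ez' -> -> p0]]]].
have [||ll vz] := @iota_out l v l' z0; rewrite -?ez //.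
  by move: oz; rewrite /qover ez iota_proj.
by subst l' z0; exists l, u, (v :: s0), y0; rewrite /= ez uv.
Qed.

Let prefix l x0 s : path qadj (iota l x0) s ->
  (exists s0, path (@padj P) x0 s0 /\ s = map (iota l) s0) \/
  (exists s0 z s2, [/\ path (@padj P) x0 s0, s = map (iota l) s0 ++ z :: s2 &
     ~ exists z0, z = iota l z0 /\ padj (last x0 s0) z0]).
Proof.
elim: s x0 => [|z s IHs] x0 /=; first by left; exists [::].
move=> /andP[xz pz].
have [z0 /andP[/eqP ez xz0]|none] :=
    pickP (fun z0 => (z == iota l z0) && padj x0 z0); last first.
  right; exists [::], z, s; split=> // -[z0 [ez xz0]].
  by have := none z0; rewrite /= ez eqxx xz0.
rewrite ez in pz *.
have [[s0 [p0 ->]]|[s0 [y [s2 [p0 -> no]]]]] := IHs _ pz.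
  by left; exists (z0 :: s0); rewrite /= xz0.
by right; exists (z0 :: s0), y, s2; rewrite /= xz0.
Qed.

Let suffix l y v s : path qadj v s -> all (fun q => ~~ qover q) s -> last v s = iota l y ->
  exists v0 t0, [/\ v = iota l v0, path (@padj P) v0 t0 & s = map (iota l) t0].
Proof.
case/lastP: s => [|s q]; first by move=> _ _ /= ->; exists y, [::].
rewrite all_rcons last_rcons => pq /andP[oq /(segment pq)].
case=> [l' [v0 [t0 [q0 [-> -> eq p0]]]]] eqy.
have [||<- _] := @iota_out l' q0 l y; rewrite -?eq //.
  by move: oq; rewrite /qover eq iota_proj.
by exists v0, (rcons t0 q0); rewrite map_rcons eq.
Qed.

(** If the walk leaves the copy [l] of the picture at [u0], injectivity over the base lets it meet
    the glued part only once more, at [v], after which it stays in the copy [l]. It is thus compared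
    with a walk in [P] in which the excursion [s3] is replaced. *)
Let q_near_induced : base_conform -> copies_near_induced F qadj qcop n.+1.
Proof.
move=> conf; have [hind hnear _] := conf; have [_ pnear _] := p_conform P conf.
move=> c cQ i j s ps ls sn; have AH := qcop_proj cQ.
have hom x t : path qadj x t -> path hadj (qproj x) (map qproj t).
  by rewrite path_map; apply: sub_path => ? ?; apply: qadj_hom.
(* With a repeated projection the walk shortens in the base, to length at most [n], where the
   hypothesis on the base applies. *)
have [us|nus] := boolP (uniq (map qproj (c i :: s))); last first.
  left; have := hom _ _ ps; have szm : size (map qproj s) = size s by rewrite size_map.
  have lsm : last (qproj (c i)) (map qproj s) = qproj (c j) by rewrite last_map ls.
  move=> pm; move: lsm nus; rewrite [map qproj (_ :: _)]/=.
  case/shortenP: pm => s' ps' us' sub' ls' nus.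
  have lt_s : size s' < size s.
    rewrite ltnNge; apply: contra nus => le_s.
    have sub1 : {subset qproj (c i) :: s' <= qproj (c i) :: map qproj s}.
      by move=> x; rewrite !inE => /predU1P[->|/sub' ->]; rewrite ?eqxx ?orbT.
    by rewrite (leq_size_uniq us' sub1) // /= szm.
  have := hnear _ AH i j s'; rewrite !ffunE => /(_ ps' ls').
  have -> : size s' <= n by rewrite -ltnS (leq_trans lt_s sn).
  case=> // [[t [pt lt st]]|[t [pt est]]]; first by exists t; rewrite pt lt (ltn_trans st).
  exists t; rewrite pt; split=> //; last by rewrite est size_map in lt_s.
  by apply: (hcop_inj AH); rewrite -last_map -est !ffunE.
have [l [c0 [c0P ec]]] := qcopP _ cQ; rewrite {}ec !ffunE in ps ls us *.
have up t i' j' : path (@padj P) (c0 i') t -> last (c0 i') t = c0 j' -> size t <= n.+1 ->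
    i' = i -> j' = j -> size t <= size s ->
    (exists s', [/\ path F i s', last i s' = j & size s' < size s]) \/
    (exists s', path F i s' /\ t = map c0 s').
  move=> pt lt st ei ej le_t; rewrite {}ei {}ej in pt lt.
  have [[t' [pt' lt' st']]|//] := pnear _ c0P i j t pt lt st; last by right.
  by left; exists t'; rewrite pt' lt' (leq_trans st').
have [[s0 [p0 es]]|[s0 [z [s2 [p0 es nz]]]]] := prefix ps.
  have := up s0 i j p0; rewrite es size_map in ls sn *; rewrite last_map in ls.
  case/(_ (iota_inj ls) sn erefl erefl (leqnn _)) => [|[s' [ps' es']]]; first by left.
  right; exists s'; split=> //; rewrite es' -map_comp; apply: eq_map => k /=; by rewrite ffunE.
set u0 := last (c0 i) s0 in nz.
have ls' : last (iota l u0) (z :: s2) = iota l (c0 j).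
  by rewrite -ls es last_cat last_map.
have pz : path qadj (iota l u0) (z :: s2).
  by move: ps; rewrite es cat_path last_map => /andP[].
have ou0 : over (proj u0).
  apply/negPn/negP => nou; move: pz => /= /andP[/qadjP[l' [a [b [ab /(iota_out nou)[<- ea] ez]]]] _].
  by apply: nz; exists b; rewrite -/u0 ea.
have [|no] := boolP (has qover (z :: s2)); last first.
  have [v0 [t0 [/iota_inj<-]]] := suffix pz (etrans (all_predC _ _) no) ls'.
  by case: t0 => //= z0 t0 /andP[uz _] [ez _]; case: nz; exists z0.
case/has_split => s3 [v [s4 [es3 ov n3]]].
have [n4 uv] : all (fun q => ~~ qover q) s4 /\ proj u0 != qproj v.
  move: us; rewrite es es3 -cat_cons -map_cons !map_cat cat_uniq => /and3P[_ dis us].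
  have u0_out : proj u0 \notin map qproj s3 ++ map qproj (v :: s4).
    apply: contra dis => u0_in; apply/hasP; exists (proj u0) => //.
    by rewrite -(iota_proj l) -map_comp (map_f (qproj \o iota l)) ?mem_last.
  have uv : proj u0 != qproj v.
    by apply: contraNneq u0_out => ->; rewrite mem_cat mem_head orbT.
  split=> //; apply/allP => q q4; apply/negP => oq.
  have [e|e] := over_cases ou0 ov oq uv.
    by case/negP: u0_out; rewrite -e mem_cat inE (map_f qproj q4) !orbT.
  by move: us; rewrite cat_uniq /= -e (map_f qproj q4) /= !andbF.
move: pz ls'; rewrite es3 -cat_rcons cat_path last_cat last_rcons => /andP[p3 p4] ls4.
have [v0 [t0 [ev pt0 es4]]] := suffix p4 n4 ls4.
have [l' [u1 [s3' [v1 [eu es3' ev' p3']]]]] := segment p3 n3.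
have uv0 : proj u0 != proj v0 by rewrite -(iota_proj l v0) -ev.
have ov0 : over (proj v0) by rewrite -(iota_proj l v0) -ev.
have lv0 : last v0 t0 = c0 j.
  by apply: (@iota_inj l); rewrite -last_map -es4 -ev.
have sE : size s = size s0 + (size s3 + (size t0).+1).
  by rewrite es es3 size_cat size_map size_cat /= es4 size_map.
(* For adjacent [u0], [v0] the edge replaces the excursion and strictly shortens the walk: an empty
   excursion would mean that the walk had not left the copy [l]. *)
have [auv|nuv] := boolP (padj u0 v0).
  left; have s3_gt0 : 0 < size s3.
    case: s3 es3 {es3' n3 p3 sE} => // -[ez _].
    by case: nz; exists v0; rewrite ez ev.
  have pw : path (@padj P) (c0 i) (s0 ++ v0 :: t0) by rewrite cat_path p0 /= auv.
  have lw : last (c0 i) (s0 ++ v0 :: t0) = c0 j by rewrite last_cat.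
  have sw : size (s0 ++ v0 :: t0) < size s.
    by rewrite size_cat sE ltn_add2l -[X in X < _]add0n ltn_add2r.
  have [[s' [ps' ls1 ss']]|[s' [ps' es']]] := pnear _ c0P _ _ _ pw lw (ltnW (leq_trans sw sn)).
    by exists s'; rewrite ps' ls1 (ltn_trans ss').
  exists s'; rewrite ps'; split=> //; last by rewrite es' size_map in sw.
  by apply: (proj_inj c0P); rewrite -last_map -es' lw.
(* The excursion runs in another copy [l'], but its ends have the same preimages there, so it can be
   read in [P] without a change of length. *)
have [eu1 ev1] := iota_share uv0 ou0 ov0 eu (etrans (esym ev) ev') nuv.
rewrite -{}eu1 -{}ev1 in p3' *.
have pw : path (@padj P) (c0 i) (s0 ++ rcons s3' v0 ++ t0).
  by rewrite !cat_path p0 p3' last_rcons.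
have lw : last (c0 i) (s0 ++ rcons s3' v0 ++ t0) = c0 j by rewrite !last_cat last_rcons.
have sw : size (s0 ++ rcons s3' v0 ++ t0) = size s.
  by rewrite !size_cat size_rcons sE es3' size_map addSnnS.
rewrite -sw in sn.
have [[s' [ps' ls1 ss']]|[s' [ps' es']]] := pnear _ c0P _ _ _ pw lw sn.
  by left; exists s'; rewrite ps' ls1 -sw.
(* If the lifted walk runs inside [c0], then so do [u0] and [v0]. They lie over an edge, and both
   [c0] and its projection are induced, which contradicts their being nonadjacent. *)
have in_c0 x : x \in c0 i :: s0 ++ rcons s3' v0 ++ t0 -> exists a, x = c0 a.
  rewrite es' inE => /predU1P[->|/mapP[a _ ->]]; by [exists i | exists a].
have [|a ua] := in_c0 u0; first by rewrite -cat_cons mem_cat mem_last.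
have [|b vb] := in_c0 v0; first by rewrite inE !mem_cat mem_rcons mem_head !orbT.
case/negP: nuv; rewrite ua vb (pcop_ind c0P) -(hind _ (pcop_proj c0P)) !ffunE -ua -vb.
exact: over_adj.
Qed.

(** Copies of F from different copies of [P] meet only over [i0] and [j0]. Two common vertices
    therefore lie over an edge of the base, and since the copies in the base are induced, they form
    an edge of F. *)
Let q_clean : base_conform -> copies_clean F qcop.
Proof.
move=> conf; have [hind _ _] := conf; have [pclean _ _] := p_conform P conf.
move=> _ _ /qcopP[l [c [cP ->]]] /qcopP[l' [c' [c'P ->]]] ne i j k k' ik.
rewrite !ffunE; have [ell|nell] := eqVneq l l'.
  subst l'; have ncc : c != c' by apply: contraNneq ne => ->.
  move=> /iota_inj ej /iota_inj ek; have [Fik mem2] := pclean _ _ cP c'P ncc _ _ _ _ ik ej ek.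
  by split=> // p q; rewrite !ffunE => /iota_inj/mem2.
have ov x y : iota l (c x) = iota l' (c' y) -> over (proj (c x)).
  by case/iota_eq=> [[e]|[]//]; rewrite e eqxx in nell.
move=> /ov oi /ov ok; have pik : proj (c i) != proj (c k).
  by apply: contraNneq ik => /(proj_inj cP) ->.
split; first by have := over_adj oi ok pik; have := hind _ (pcop_proj cP) i k; rewrite !ffunE => ->.
move=> p q; rewrite !ffunE => /ov op.
by have [/(proj_inj cP)|/(proj_inj cP)] := over_cases oi ok op pik; [left | right].
Qed.

(** A closed walk that is not injective over the base is split there. Otherwise it meets the glued
    part in at most two vertices [u], [v]. If their preimages are nonadjacent, both arcs lift to a
    single closed walk in [P]; if adjacent, a chord is available. *)
Let q_odd_walks : base_conform -> odd_walks_bounded F qadj n.+1.*2.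
Proof.
move=> conf; have [_ _ hodd] := conf; have [_ _ podd] := p_conform P conf.
move=> s cs os sn; have cm : cycle hadj (map qproj s).
  by rewrite cycle_map; apply: sub_cycle cs => ? ?; apply: qadj_hom.
have [us|nus] := boolP (uniq (map qproj s)); last first.
  have [|s' [cs' os' ss']] := odd_cycle_split cm _ nus; first by rewrite size_map.
  rewrite size_map in ss'.
  have [|t [ct ot st]] := hodd s' cs' os'; first by rewrite -(leq_add2r 2) (leq_trans ss') // addn2 -doubleS.
  by exists t; split=> //; rewrite (leq_trans st) // (leq_trans _ ss') ?leq_addr.
have single x s1 : cycle qadj (x :: s1) -> odd (size (x :: s1)) -> size (x :: s1) <= n.+1.*2 ->
    all (fun q => ~~ qover q) s1 ->
    exists s', [/\ cycle F s', odd (size s') & size s' <= size (x :: s1)].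
  move=> /= /segment seg od sz /seg[l [x0 [s0 [y0 [ex es1 ey p0]]]]].
  have exy : x0 = y0 by apply: (@iota_inj l); rewrite -ex.
  subst y0; have := podd (x0 :: s0) p0; rewrite /= es1 size_map in od sz *.
  by apply.
have [/hasP[u us_u ou]|/hasPn no] := boolP (has qover s); last first.
  case: s cs os sn us no {cm} => // x s cs os sn us no; apply: single => //.
  by apply/allP => q qs; apply: no; rewrite inE qs orbT.
have [k s1 es] := rot_to us_u.
move: cs os sn us; rewrite -(rot_cycle k) -(size_rot k) es => cs os sn.
rewrite -(rot_uniq k) -map_rot es => us.
have [|no] := boolP (has qover s1); last first.
  by apply: single => //; rewrite all_predC.
case/has_split => s3 [v [s4 [es1 ov n3]]]; rewrite {}es1 in cs os sn us *.
have uv : qproj u != qproj v.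
  by move: us => /= /andP[+ _]; apply: contraNneq => ->; rewrite map_f // mem_cat mem_head orbT.
have n4 : all (fun q => ~~ qover q) s4.
  apply/allP => q q4; apply/negP => oq; move: us => /= /andP[u_out].
  rewrite map_cat cat_uniq /= => /and4P[_ _ v_out _].
  have [e|e] := over_cases ou ov oq uv.
    by case/negP: u_out; rewrite -e map_f // mem_cat inE q4 !orbT.
  by case/negP: v_out; rewrite -e map_f.
have {cs}/andP[p3 p4] : path qadj u (rcons s3 v) && path qadj v (rcons s4 u).
  by move: cs; rewrite /= rcons_cat rcons_cons -cat_rcons cat_path last_rcons.
have [l1 [u1 [s3' [v1 [eu1 es3 ev1 pp3]]]]] := segment p3 n3.
have [l2 [v2 [s4' [u2 [ev2 es4 eu2 pp4]]]]] := segment p4 n4.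
have szE : size (u :: s3 ++ v :: s4) = (size s3').+1 + (size s4').+1.
  by rewrite /= size_cat es3 es4 /= !size_map addSn.
rewrite szE in os sn *.
have uv1 : proj u1 != proj v1 by rewrite -(iota_proj l1 u1) -(iota_proj l1 v1) -eu1 -ev1.
have ou1 : over (proj u1) by rewrite -(iota_proj l1 u1) -eu1.
have ov1 : over (proj v1) by rewrite -(iota_proj l1 v1) -ev1.
have [auv|nuv] := boolP (padj u1 v1); last first.
  have [eu ev] := iota_share uv1 ou1 ov1 (etrans (esym eu1) eu2) (etrans (esym ev1) ev2) nuv.
  rewrite -{}eu -{}ev in pp4.
  have cw : cycle (@padj P) (u1 :: s3' ++ v1 :: s4').
    by rewrite /= rcons_cat rcons_cons -cat_rcons cat_path pp3 last_rcons.
  have sw : size (u1 :: s3' ++ v1 :: s4') = (size s3').+1 + (size s4').+1.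
    by rewrite /= size_cat addSn.
  by have := podd _ cw; rewrite sw; apply.
have auv2 : padj u2 v2 by rewrite -(qadj_iota l2) -eu2 -ev2 eu1 ev1 qadj_iota.
(* The chord turns the arc with an even number of edges into an odd closed walk. *)
have [od|ev] := boolP (odd (size s3')).
  have cw : cycle (@padj P) (u1 :: rcons s3' v1) by rewrite /= rcons_path pp3 last_rcons padj_sym.
  have [||t [ct ot st]] := podd _ cw; rewrite /= ?size_rcons.
  - by move: od; rewrite /= negbK.
  - by apply: leq_trans sn; rewrite addnS ltnS leq_addr.
  by exists t; rewrite ct ot (leq_trans st) //= size_rcons addnS ltnS leq_addr.
have cw : cycle (@padj P) (v2 :: rcons s4' u2) by rewrite /= rcons_path pp4 last_rcons.
have [||t [ct ot st]] := podd _ cw; rewrite /= ?size_rcons.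
- by move: os; rewrite oddD /= (negbTE ev).
- by apply: leq_trans sn; rewrite addSn ltnS leq_addl.
by exists t; rewrite ct ot (leq_trans st) //= size_rcons addSn ltnS leq_addl.
Qed.

Definition amalgam : picture :=
  @Picture Q qadj qproj qcop qadj_sym qadj_hom qcop_proj qcop_ind q_cliques
    (fun conf => And3 (q_clean conf) (q_near_induced conf) (q_odd_walks conf)).

Definition amalgam_emb (l : L) (u : pvert P) : pvert amalgam := iota l u.

Lemma amalgam_embP l : @embedding P amalgam (amalgam_emb l).
Proof.
split=> [||u v uv|c cP]; first exact: iota_inj.
- exact: iota_proj.
- by rewrite /= qadj_iota.
- by apply/qcopP; exists l, c.
Qed.

End Amalgam.
End Pictures.

(** * Regularising a colouring of a picture *)

Section Stages.
Variables (m : nat) (F : rel 'I_m) (w n : nat).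
Variables (W : finType) (hadj : rel W) (hcop : {set {ffun 'I_m -> W}}) (lev : W -> nat).
Hypothesis w_gt1 : 1 < w.
Hypothesis hadj_sym : symmetric hadj.
Hypothesis hadj_irr : irreflexive hadj.
Hypothesis hcop_inj : forall c, c \in hcop -> injective c.
Local Notation pic := (picture F w n hadj hcop).
Implicit Types P Q : pic.

Definition hedge (i j : W) := hadj i j && (lev i < lev j).

Definition over_edge P (i j : W) (u v : pvert P) :=
  [/\ proj u = i, proj v = j & padj u v].

(* The colour of an edge over ij determines, and is determined by, its end over
   i (if a) and its end over j (if b). *)
Definition typed (D : Type) (a b : bool) (i j : W) P (phi : pvert P -> pvert P -> D) :=
  forall u v u' v', over_edge i j u v -> over_edge i j u' v' ->
  phi u v = phi u' v' <-> (a -> u = u') /\ (b -> v = v').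

Definition pull (D : Type) P Q (e : pvert P -> pvert Q) (phi : pvert Q -> pvert Q -> D) :=
  fun u v => phi (e u) (e v).

Lemma embedding_comp P Q R (e : pvert P -> pvert Q) (f : pvert Q -> pvert R) :
  embedding e -> embedding f -> embedding (f \o e).
Proof.
move=> [ie pe ae ce] [jf pf af cf]; split=> [||u v /ae/af //|c /ce/cf].
- exact: inj_comp.
- by move=> u /=; rewrite pf pe.
- by rewrite [X in X \in _ -> _](_ : _ = [ffun i => (f \o e) (c i)]) //; apply/ffunP => i; rewrite !ffunE.
Qed.

Lemma embedding_id P : @embedding _ _ _ _ _ _ _ P P id.
Proof.
split=> // c cP; suff -> : [ffun i => id (c i)] = c by [].
by apply/ffunP => i; rewrite ffunE.
Qed.

Lemma over_edge_emb P Q (e : pvert P -> pvert Q) i j u v :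
  embedding e -> over_edge i j u v -> over_edge i j (e u) (e v).
Proof. by move=> [_ pe ae _] [<- <- /ae uv]; split; rewrite ?pe. Qed.

Lemma typed_pull (D : Type) a b i j P Q (e : pvert P -> pvert Q) (phi : pvert Q -> pvert Q -> D) :
  embedding e -> typed a b i j phi -> typed a b i j (pull e phi).
Proof.
move=> ee ty u v u' v' /(over_edge_emb ee) uv /(over_edge_emb ee) uv'.
have [inj_e _ _ _] := ee; apply: iff_trans (ty _ _ _ _ uv uv') _.
by split=> -[ha hb]; split=> [/ha|/hb]; [apply: inj_e | apply: inj_e | move=> -> | move=> ->].
Qed.

Section Iterate.
Variables (D X : Type) (K : eqType).
Variables (good : X -> forall P, (pvert P -> pvert P -> D) -> Prop).
Variables (post : K -> X -> forall P, (pvert P -> pvert P -> D) -> Prop).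
Hypothesis good_pull : forall x P Q (e : pvert P -> pvert Q) phi,
  embedding e -> good x phi -> good x (pull e phi).
Hypothesis post_pull : forall k x P Q (e : pvert P -> pvert Q) phi,
  embedding e -> post k x phi -> post k x (pull e phi).
Hypothesis step : forall k P, exists Q : pic, forall x phi, good x phi ->
  exists2 e : pvert P -> pvert Q, embedding e & post k x (pull e phi).

(** All properties pass to subpictures, so what a later amalgamation has achieved survives the
    restriction to earlier ones. The parameter [x] is quantified after [Q] because it will be the
    family of types, which depends on the colouring. *)
Lemma iterate_stages (ks : seq K) P : exists Q : pic, forall x phi, good x phi ->
  exists2 e : pvert P -> pvert Q, embedding e & forall k, k \in ks -> post k x (pull e phi).
Proof.
elim: ks => [|k ks [Q1 IH]].
  by exists P => x phi _; exists id => //; apply: embedding_id.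
have [Q stepQ] := step k Q1; exists Q => x phi gphi.
have [e2 ee2 post2] := stepQ x phi gphi.
have [e1 ee1 post1] := IH x _ (good_pull ee2 gphi).
exists (e2 \o e1); first exact: embedding_comp.
move=> k'; rewrite inE => /predU1P[->|/post1 //].
exact: (post_pull ee1 post2).
Qed.
End Iterate.

Lemma amalgam_exists P (i0 j0 : W) (Z L : finType) (zproj : Z -> W) (lam : L -> pvert P -> Z) :
  let over x := (x == i0) || (x == j0) in
  (i0 != j0 -> hadj i0 j0) ->
  (forall z, over (zproj z)) ->
  (forall l u, over (proj u) -> zproj (lam l u) = proj u) ->
  (forall l u v, over (proj u) -> over (proj v) -> lam l u = lam l v -> u = v) ->
  (forall l l' u v u' v',
    over (proj u) -> over (proj v) -> over (proj u') -> over (proj v') ->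
    proj u != proj v -> lam l u = lam l' u' -> lam l v = lam l' v' -> ~~ padj u v ->
    u = u' /\ v = v') ->
  exists (Q : pic) (e : L -> pvert P -> pvert Q) (glue : Z -> pvert Q),
    [/\ forall l, embedding (e l),
        forall l u, over (proj u) -> e l u = glue (lam l u),
        forall l u l' u', e l u = e l' u' -> ~~ over (proj u) -> l = l' &
        forall z, proj (glue z) = zproj z].
Proof.
move=> over h1 h2 h3 h4 h5.
exists (amalgam w_gt1 hadj_sym hadj_irr hcop_inj h1 h2 h3 h4 h5).
exists (@amalgam_emb m F w n W hadj hcop w_gt1 hadj_sym hadj_irr hcop_inj P i0 j0 Z L zproj lam h1 h2 h3 h4 h5).
exists (fun z => inl z); split=> // [l|l u|l u l' u'].
- exact: amalgam_embP.
- by rewrite /over /amalgam_emb => ->.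
- by rewrite /over /amalgam_emb => + /negbTE out; rewrite out; case: ifP => // _ [].
Qed.

(** Some end that determines the colours over [i'j'] lies off [i] and [j]. A colour common to both
    edges is then accidental: no canonical colouring requires it. *)
Definition separated (t : W -> W -> bool * bool) (i j i' j' : W) :=
  ((t i' j').1 && (i' \notin [:: i; j])) || ((t i' j').2 && (j' \notin [:: i; j])).

Definition disjoint_palettes (ij : W * W) (t : W -> W -> bool * bool) P (phi : pvert P -> pvert P -> nat) :=
  hedge ij.1 ij.2 -> forall i' j', hedge i' j' -> separated t ij.1 ij.2 i' j' ->
  forall u v u' v', over_edge ij.1 ij.2 u v -> over_edge i' j' u' v' -> phi u v <> phi u' v'.

Definition all_typed (t : W -> W -> bool * bool) P (phi : pvert P -> pvert P -> nat) :=
  forall i j, hedge i j -> typed (t i j).1 (t i j).2 i j phi.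

(* A fan consists of many copies glued along the lines over i and j.  Edges of the
   same colour over i'j' with a separated end off these lines lie in one copy, so
   some copy contains no such edge in the colour of an edge over ij. *)
Lemma fan_step (ij : W * W) P : exists Q : pic, forall t phi, all_typed t phi ->
  exists2 e : pvert P -> pvert Q, embedding e & disjoint_palettes ij t (pull e phi).
Proof.
case: ij => i j; have [hij|nhij] := boolP (hedge i j); last first.
  by exists P => t phi _; exists id; [apply: embedding_id | move=> hij; rewrite hij in nhij].
have [hadj_ij lt_ij] := andP hij.
pose V := pvert P; pose B : finType := ((W * W) * (V * V))%type; pose over x := (x == i) || (x == j).
(* There is one copy more than there are choices of a line [i'j'] together with an edge over
   [ij]. *)
have [|||||Q [e [glue [ee eg eout _]]]] := @amalgam_exists P i j V 'I_(#|B|.+1)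
  (fun u => if over (proj u) then proj u else i) (fun _ u => u).
- by [].
- by move=> u; case: ifP => //; rewrite eqxx.
- by move=> _ u; rewrite /over => ->.
- by [].
- by [].
exists Q => t phi ty.
pose clash l (x : B * (V * V)) : bool :=
  let: (((i', j'), (u, v)), (u', v')) := x in
  [&& hedge i' j', separated t i j i' j', proj u == i, proj v == j, padj u v,
      proj u' == i', proj v' == j', padj u' v' & phi (e l u) (e l v) == phi (e l u') (e l v')].
have [l good|all_bad] := pickP (fun l => ~~ [exists x, clash l x]).
  exists (e l) => // _ i' j' h' sep u v u' v' [pu pv uv] [pu' pv' uv'] eq_phi.
  case/existsP: good; exists (((i', j'), (u, v)), (u', v')).
  by rewrite /clash h' sep uv uv' pu pv pu' pv' !eqxx /=; apply/eqP.
have /fin_all_exists[g gP] : forall l, exists x, clash l x.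
  by move=> l; apply/existsP; have /negbFE := all_bad l.
have g_inj : injective (fun l => (g l).1).
  move=> l1 l2; have := gP l1; have := gP l2.
  case: (g l1) => -[[i1 j1] [u1 v1]] [u1' v1']; case: (g l2) => -[[i2 j2] [u2 v2]] [u2' v2'] /=.
  move=> /and5P[h2 sep2 /eqP pu2 /eqP pv2 /and5P[uv2 /eqP pu2' /eqP pv2' uv2' /eqP e2]].
  move=> /and5P[h1 sep1 /eqP pu1 /eqP pv1 /and5P[uv1 /eqP pu1' /eqP pv1' uv1' /eqP e1]].
  move=> [ei ejj eu ev]; subst i2 j2 u2 v2.
  have ou : over (proj u1) by rewrite /over pu1 eqxx.
  have ov : over (proj v1) by rewrite /over pv1 eqxx orbT.
  have eq' : phi (e l1 u1') (e l1 v1') = phi (e l2 u2') (e l2 v2').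
    by rewrite -e1 -e2 !eg.
  have o1 : over_edge i1 j1 (e l1 u1') (e l1 v1') by apply: over_edge_emb.
  have o2 : over_edge i1 j1 (e l2 u2') (e l2 v2') by apply: over_edge_emb.
  have [sepL sepR] := (ty _ _ h1 _ _ _ _ o1 o2).1 eq'.
  case/orP: sep1 => /andP[sep out].
    by apply: eout (sepL sep) _; rewrite pu1'; move: out; rewrite !inE.
  by apply: eout (sepR sep) _; rewrite pv1'; move: out; rewrite !inE.
by have := leq_card _ g_inj; rewrite card_ord ltnn.
Qed.

(* If the colour of an edge over ik depends on its end u over i only, then u
   induces a colouring of the lines k; the kernel of this colouring does not
   depend on u. *)
Definition uniform_vertices (i : W) (t : W -> W -> bool * bool) P (phi : pvert P -> pvert P -> nat) :=
  exists r r' : W -> nat,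
    (forall k k' u v v', hedge i k -> hedge i k' ->
      t i k = (true, false) -> t i k' = (true, false) ->
      over_edge i k u v -> over_edge i k' u v' -> phi u v = phi u v' <-> r k = r k') /\
    (forall k k' u v v', hedge k i -> hedge k' i ->
      t k i = (false, true) -> t k' i = (false, true) ->
      over_edge k i v u -> over_edge k' i v' u -> phi v u = phi v' u <-> r' k = r' k').

(** Copies are attached to a large set [Z] over [i] by all injections. The pigeonhole principle
    gives more than [#|V|] elements of [Z] with the same pattern of colours, and one of the copies
    has all its vertices over [i] among them. *)
Lemma vertex_step (i : W) P : exists Q : pic, forall t phi, all_typed t phi ->
  exists2 e : pvert P -> pvert Q, embedding e & uniform_vertices i t (pull e phi).
Proof.
pose V := pvert P; pose C : finType := {ffun W * W -> bool * bool}.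
pose Z : finType := 'I_(#|C| * #|V|).+1.
pose L : finType := {l : {ffun V -> Z} | injectiveb l}.
have [|||l u v _ _ e||Q [e [glue [ee eg _ eproj]]]] :=
  @amalgam_exists P i i Z L (fun _ => i) (fun l u => val l u).
- by rewrite eqxx.
- by move=> z; rewrite eqxx.
- by move=> l u; rewrite orbb => /eqP ->.
- by have /injectiveP inj := valP l; apply: inj.
- move=> l l' u v u' v'; rewrite !orbb => /eqP -> /eqP -> _ _.
  by rewrite eqxx.
exists Q => t phi ty; pose VQ := pvert Q.
pose nbr (z : VQ) k (v : VQ) := (proj v == k) && padj z v.
pose pat (z : Z) : C := [ffun kk =>
  ([exists v : VQ, exists v' : VQ, [&& nbr (glue z) kk.1 v, nbr (glue z) kk.2 v' &
      phi (glue z) v == phi (glue z) v']],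
   [exists v : VQ, exists v' : VQ, [&& nbr (glue z) kk.1 v, nbr (glue z) kk.2 v' &
      phi v (glue z) == phi v' (glue z)]])].
have [|c] := @pigeonhole_seq _ _ pat #|V| (enum Z).
  by rewrite -cardE card_ord.
rewrite -size_filter; set S := filter _ _ => ltS.
have uS : uniq S by rewrite filter_uniq ?enum_uniq.
have SP z : z \in S -> pat z = c by rewrite mem_filter => /andP[/eqP].
have [zs zsS] : exists z, z \in S by case: S ltS {uS SP} => // z S' _; exists z; rewrite mem_head.
have [l0 l0S l0_inj] : exists2 l0 : {ffun V -> Z}, forall u, l0 u \in S & injective l0.
  have rank_lt (u : V) : enum_rank u < size S by apply: leq_trans ltS; apply: ltnW; rewrite ltnS.
  exists [ffun u => nth zs S (enum_rank u)] => [u|u v]; first by rewrite ffunE mem_nth.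
  by rewrite !ffunE => /eqP; rewrite nth_uniq // => /eqP/val_inj; apply: enum_rank_inj.
pose l : L := Sub l0 (introT (injectiveP _) l0_inj).
exists (e l) => //; have el := ee l; have [e_inj e_proj e_adj _] := el.
have glueE u : proj u = i -> e l u = glue (l0 u) by move=> pu; rewrite eg // pu eqxx.
(* composing l0 with a transposition puts u at the reference vertex zs *)
have move_to (u v : V) k : proj u = i -> proj v = k -> padj u v -> exists x, nbr (glue zs) k x.
  move=> pu pv uv; pose l1 : {ffun V -> Z} := [ffun x => tperm (l0 u) zs (l0 x)].
  have l1_inj : injective l1 by move=> x y; rewrite !ffunE => /perm_inj/l0_inj.
  pose l' : L := Sub l1 (introT (injectiveP _) l1_inj).
  have [_ pe ae _] := ee l'; exists (e l' v); rewrite /nbr pe pv eqxx /=.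
  have <- : e l' u = glue zs; last exact: ae.
  by rewrite eg ?pu ?eqxx //= ffunE tpermL.
(* The colours at the reference vertex serve as labels of the lines; the default 0 occurs only when
   [P] has no edge over [i] and [k]. *)
pose ref f k : nat := if [pick x | nbr (glue zs) k x] is Some x then f (glue zs) x else 0.
exists (ref phi), (ref (fun x y => phi y x)); split.
- move=> k k' u v v' hk hk' tk tk' [pu pv uv] [_ pv' uv'].
  (* By the type, the colour does not depend on the neighbour chosen over [k], so the existential in
     [pat] speaks of all pairs of neighbours. *)
  have key z x x' y y' : proj (glue z) = i -> nbr (glue z) k x -> nbr (glue z) k y ->
      nbr (glue z) k' x' -> nbr (glue z) k' y' ->
      phi (glue z) x = phi (glue z) y /\ phi (glue z) x' = phi (glue z) y'.
    move=> pz /andP[/eqP px zx] /andP[/eqP py zy] /andP[/eqP px' zx'] /andP[/eqP py' zy'].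
    have := ty _ _ hk; rewrite tk => /(_ (glue z) x (glue z) y) [] // _ ->; last by split.
    by have := ty _ _ hk'; rewrite tk' => /(_ (glue z) x' (glue z) y') [] // _ ->.
  have patP z x x' : nbr (glue z) k x -> nbr (glue z) k' x' ->
      (pat z (k, k')).1 <-> phi (glue z) x = phi (glue z) x'.
    move=> zx zx'; rewrite ffunE /=; split=> [/existsP[y /existsP[y' /and3P[zy zy' /eqP eyy]]]|e'].
      by have [-> ->] := key z x x' y y' (eproj z) zx zy zx' zy'.
    by apply/existsP; exists x; apply/existsP; exists x'; rewrite zx zx'; apply/eqP.
  have [x0 zx0] := move_to _ _ _ pu pv uv; have [x0' zx0'] := move_to _ _ _ pu pv' uv'.
  rewrite /ref; case: pickP => [x zx|/(_ x0)]; last by rewrite zx0.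
  case: pickP => [x' zx'|/(_ x0')]; last by rewrite zx0'.
  apply: iff_trans (patP zs x x' zx zx'); rewrite (SP _ zsS) -(SP _ (l0S u)).
  by apply: iff_sym; rewrite /pull (glueE u) //; apply: patP; rewrite /nbr e_proj -(glueE u) // e_adj ?pv ?pv' ?eqxx.
- move=> k k' u v v' hk hk' tk tk' [pv pu uv] [pv' _ uv'].
  have key z x x' y y' : proj (glue z) = i -> nbr (glue z) k x -> nbr (glue z) k y ->
      nbr (glue z) k' x' -> nbr (glue z) k' y' ->
      phi x (glue z) = phi y (glue z) /\ phi x' (glue z) = phi y' (glue z).
    move=> pz /andP[/eqP px zx] /andP[/eqP py zy] /andP[/eqP px' zx'] /andP[/eqP py' zy'].
    rewrite padj_sym in zx; rewrite padj_sym in zy.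
    rewrite padj_sym in zx'; rewrite padj_sym in zy'.
    have := ty _ _ hk; rewrite tk => /(_ x (glue z) y (glue z)) [] // _ ->; last by split.
    by have := ty _ _ hk'; rewrite tk' => /(_ x' (glue z) y' (glue z)) [] // _ ->.
  have patP z x x' : nbr (glue z) k x -> nbr (glue z) k' x' ->
      (pat z (k, k')).2 <-> phi x (glue z) = phi x' (glue z).
    move=> zx zx'; rewrite ffunE /=; split=> [/existsP[y /existsP[y' /and3P[zy zy' /eqP eyy]]]|e'].
      by have [-> ->] := key z x x' y y' (eproj z) zx zy zx' zy'.
    by apply/existsP; exists x; apply/existsP; exists x'; rewrite zx zx'; apply/eqP.
  rewrite padj_sym in uv; rewrite padj_sym in uv'.
  have [x0 zx0] := move_to _ _ _ pu pv uv; have [x0' zx0'] := move_to _ _ _ pu pv' uv'.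
  rewrite /ref; case: pickP => [x zx|/(_ x0)]; last by rewrite zx0.
  case: pickP => [x' zx'|/(_ x0')]; last by rewrite zx0'.
  apply: iff_trans (patP zs x x' zx zx'); rewrite (SP _ zsS) -(SP _ (l0S u)).
  by apply: iff_sym; rewrite /pull (glueE u) //; apply: patP; rewrite /nbr e_proj -(glueE u) // e_adj ?pv ?pv' ?eqxx.
Qed.

(* The bipartite graph over ij, with a new vertex None over i that is adjacent to
   all vertices over j; its edges form the alphabet of the Hales-Jewett theorem. *)
Section Power.
Variables (P : pic) (i j : W).
Hypothesis hij : hedge i j.
Let V := pvert P.

Definition aug_edge (x : option V * V) : bool :=
  (proj x.2 == j) && (if x.1 is Some u then (proj u == i) && padj u x.2 else true).

(* None stands for the identity; the other letters map all pairs of vertices over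
   i and j to edges, so that nonadjacency is only witnessed by the identity. *)
Definition letter : finType := option ({ffun V -> option V} * {ffun V -> V}).

Definition act1 (u : V) (k : letter) : option V := if k is Some g then g.1 u else Some u.
Definition act2 (v : V) (k : letter) : V := if k is Some g then g.2 v else v.

Definition edge_letter (k : letter) : bool :=
  if k is Some g then
    [forall u, forall v, (proj u == i) && (proj v == j) ==> aug_edge (g.1 u, g.2 v)]
  else true.

(** The glued parts over [i] and [j] are N-th powers, and each word of letters containing the
    identity gives a copy of [P]. The colouring of the edges over [ij] is thereby read from a
    colouring [Phi] of words of augmented edges. *)
Lemma power_amalgam (v0 : V) (N : nat) : exists Q : pic, forall (D : Type) (phi : pvert Q -> pvert Q -> D),
  exists Phi : seq (option V * V) -> D,
  forall l : seq letter, size l = N -> None \in l -> all edge_letter l ->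
  exists2 e : V -> pvert Q, embedding e & forall u v, over_edge i j u v ->
    phi (e u) (e v) = Phi [seq (act1 u k, act2 v k) | k <- l].
Proof.
have [hadj_ij lt_ij] := andP hij.
have neq_ij : i != j by apply: contraTneq lt_ij => ->; rewrite ltnn.
pose L : finType := {l : N.-tuple letter | (None \in l) && all edge_letter l}.
pose Z : finType := (N.-tuple (option V) + N.-tuple V)%type.
pose zp (z : Z) := if z is inl _ then i else j.
pose lam (l : L) (u : V) : Z :=
  if proj u == i then inl (map_tuple (act1 u) (val l)) else inr (map_tuple (act2 u) (val l)).
have share (l l' : L) u v u' v' : proj u = i -> proj v = j -> proj u' = i -> proj v' = j ->
    lam l u = lam l' u' -> lam l v = lam l' v' -> ~~ padj u v -> u = u' /\ v = v'.
  rewrite /lam => pu pv pu' pv'; rewrite pu pv pu' pv' eqxx (eq_sym j) (negbTE neq_ij) => -[e1] [e2] nuv.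
  (* At a coordinate [t] where [l] has the identity, the images are [u] and [v] themselves. Any
     letter of [l'] there other than the identity would make them adjacent. *)
  have /andP[/(nthP None)[t lt_t et] _] := valP l; have /andP[_ /allP ok'] := valP l'.
  rewrite size_tuple in lt_t.
  have := congr1 (fun z => nth v0 z t) e2; have := congr1 (fun z => nth None z t) e1.
  rewrite !(nth_map None) ?size_tuple // et.
  have /ok' : nth None (val l') t \in val (val l') by rewrite mem_nth ?size_tuple.
  case: (nth _ _ t) => [g|] /=; last by move=> _ [->] ->.
  move=> /forallP/(_ u')/forallP/(_ v') + eu ev; rewrite -eu -ev pu' pv' !eqxx /=.
  by rewrite /aug_edge /= (negbTE nuv) !andbF.
have lamE (l : L) u v : proj u = i -> proj v = j ->
    lam l u = inl (map_tuple (act1 u) (val l)) /\ lam l v = inr (map_tuple (act2 v) (val l)).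
  by rewrite /lam => -> ->; rewrite eqxx (eq_sym j) (negbTE neq_ij).
have [|||||Q [e [glue [ee eg _ _]]]] := @amalgam_exists P i j Z L zp lam.
- by [].
- by case=> z; rewrite eqxx ?orbT.
- by move=> l u; rewrite /lam; case: eqP => [->|_ /eqP ->].
- move=> l u v; have /andP[lN _] := valP l.
  move=> _ _; rewrite /lam; case: (proj u =P i); case: (proj v =P i) => // _ _.
    by move=> [/eq_in_map/(_ None lN)[]].
  by move=> [/eq_in_map/(_ None lN)].
- move=> l l' u v u' v' /orP[]/eqP pu /orP[]/eqP pv ou' ov'; rewrite pu pv ?eqxx //.
    case/orP: ou' => /eqP pu'; case/orP: ov' => /eqP pv' _; try exact: share.
    + by move=> _; rewrite /lam pv pv' eqxx (eq_sym j) (negbTE neq_ij).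
    + by rewrite /lam pu pu' eqxx (eq_sym j) (negbTE neq_ij).
    + by rewrite /lam pu pu' eqxx (eq_sym j) (negbTE neq_ij).
  case/orP: ou' => /eqP pu'; case/orP: ov' => /eqP pv' _.
  + by rewrite /lam pu pu' eqxx (eq_sym j) (negbTE neq_ij).
  + by rewrite /lam pu pu' eqxx (eq_sym j) (negbTE neq_ij).
  + by move=> eu ev nuv; rewrite padj_sym in nuv; have [-> ->] := share _ _ _ _ _ _ pv pu pv' pu' ev eu nuv.
  + by move=> _; rewrite /lam pv pv' eqxx (eq_sym j) (negbTE neq_ij).
exists Q => D phi.
exists (fun s => phi (glue (inl [tuple nth None (map fst s) t | t < N]))
                     (glue (inr [tuple nth v0 (map snd s) t | t < N]))).
move=> l size_l lN ok_l.
have L_ok : (None \in in_tuple l) && all edge_letter (in_tuple l) by rewrite lN ok_l.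
subst N; pose l' : L := Sub (in_tuple l) L_ok.
exists (e l') => // u v [pu pv uv].
rewrite !eg ?pu ?pv ?eqxx ?orbT //; have [-> ->] := lamE l' u v pu pv.
have nthE (T : Type) (d : T) (f : letter -> T) :
    map_tuple f (in_tuple l) = [tuple nth d (map f l) t | t < size l].
  by apply: eq_from_tnth => t; rewrite tnth_map tnth_mktuple (nth_map None) // (tnth_nth None).
by rewrite (nthE _ None) (nthE _ v0) -!map_comp.
Qed.

End Power.

Definition pairs_uniform (D : Type) (ij : W * W) P (tau : pvert P -> pvert P -> D) :=
  hedge ij.1 ij.2 -> typed false false ij.1 ij.2 tau.

Lemma edge_or_none P i j : (exists u v : pvert P, over_edge i j u v) \/
  (forall u v : pvert P, ~ over_edge i j u v).
Proof.
have [uv /and3P[/eqP ? /eqP ? ?]|no] := pickP (fun uv : pvert P * pvert P =>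
  [&& proj uv.1 == i, proj uv.2 == j & padj uv.1 uv.2]).
  by left; exists uv.1, uv.2.
by right=> u v [pu pv uv]; have := no (u, v); rewrite /= pu pv uv !eqxx.
Qed.

(** A constant letter of the Hales-Jewett word sends all pairs to one fixed edge, and the variable
    is the identity; the edges over [ij] of the resulting copy thus lie on a monochromatic line. *)
Lemma uniform_step (D : finType) (ij : W * W) P : exists Q : pic, forall tau : pvert Q -> pvert Q -> D,
  exists2 e : pvert P -> pvert Q, embedding e & pairs_uniform ij (pull e tau).
Proof.
case: ij => i j; have [hij|nhij] := boolP (hedge i j); last first.
  by exists P => tau; exists id; [apply: embedding_id | move=> hij; rewrite hij in nhij].
have [[u0 [v0 uv0]]|none] := edge_or_none P i j; last first.
  by exists P => tau; exists id; [apply: embedding_id | move=> _ u v u' v' /none].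
pose A : finType := {x : pvert P * pvert P | [&& proj x.1 == i, proj x.2 == j & padj x.1 x.2]}.
have [N hjN] := hales_jewett A D.
have [Q powQ] := power_amalgam hij v0 N; exists Q => tau.
have [Phi PhiP] := powQ D tau.
have [wd [sw wN mono]] := hjN (fun s => Phi [seq (Some (val a).1, (val a).2) | a <- s]).
pose conv (o : option A) : letter P :=
  if o is Some a then Some ([ffun=> Some (val a).1], [ffun=> (val a).2]) else None.
have [|||e ee eP] := PhiP (map conv wd).
- by rewrite size_map.
- by apply/mapP; exists None.
- rewrite all_map; apply/allP => -[a|] //= _.
  apply/forallP => u; apply/forallP => v; apply/implyP => _.
  by have /and3P[pu pv uv] := valP a; rewrite /aug_edge !ffunE /= pu pv uv.
exists e => // _ u v u' v' uv uv'; rewrite /pull !eP //; split=> // _.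
have valE (x y : pvert P) : over_edge i j x y -> exists a : A,
    [seq (act1 x k, act2 y k) | k <- map conv wd] =
    [seq (Some (val a).1, (val a).2) | a <- inst wd a].
  move=> [px py xy]; have xyA : [&& proj (x, y).1 == i, proj (x, y).2 == j & padj (x, y).1 (x, y).2].
    by rewrite /= px py xy !eqxx.
  exists (Sub (x, y) xyA); rewrite /inst -!map_comp; apply: eq_map => -[a|] //=.
  by rewrite !ffunE.
have [a ->] := valE _ _ uv; have [b ->] := valE _ _ uv'; exact: mono.
Qed.

Definition some_type (ij : W * W) P (phi : pvert P -> pvert P -> nat) :=
  exists ab : bool * bool, hedge ij.1 ij.2 -> typed ab.1 ab.2 ij.1 ij.2 phi.

(** Equality of colours is governed by a letterwise relation [E] on augmented edges. If [E]
    distinguishes two edges with the same right end ([sepL]), these serve to test the left end of an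
    edge; otherwise [E] ignores the left end. The same holds with the ends exchanged. *)
Lemma type_step (ij : W * W) P : exists Q : pic, forall phi : pvert Q -> pvert Q -> nat,
  exists2 e : pvert P -> pvert Q, embedding e & some_type ij (pull e phi).
Proof.
case: ij => i j; have [hij|nhij] := boolP (hedge i j); last first.
  exists P => phi; exists id; first exact: embedding_id.
  by exists (false, false) => hij; rewrite hij in nhij.
have [[u0 [v0 [pu0 pv0 uv0]]]|none] := edge_or_none P i j; last first.
  exists P => phi; exists id; first exact: embedding_id.
  by exists (false, false) => _ u v u' v' /none.
pose V := pvert P; pose A : finType := {x : option V * V | aug_edge i j x}.
have augA (u v : V) : over_edge i j u v -> aug_edge i j (Some u, v).
  by move=> [pu pv uv]; rewrite /aug_edge /= pu pv uv !eqxx.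
have augN (v : V) : proj v = j -> aug_edge i j (None, v) by rewrite /aug_edge /= => ->; rewrite eqxx.
pose a0 : A := Sub (Some u0, v0) (augA _ _ (And3 pu0 pv0 uv0)).
(* The variable [None] is the identity; [(true, x)] tests whether the left end is [x], and
   [(false, y)] whether the right end is [y]. *)
have [N hjN] := canonical_hales_jewett a0 (option (bool * V)).
have [Q powQ] := power_amalgam hij v0 N; exists Q => phi.
have [Phi PhiP] := powQ nat phi.
have [T [E [sT memT canon]]] := hjN (fun s => Phi (map val s)).
have ET a b : E a b <-> Phi (map val (map (subst (fun=> a)) T)) = Phi (map val (map (subst (fun=> b)) T)).
  by rewrite canon; split=> [//|/(_ None)].
have Erefl a : E a a by apply/ET.
have Esym a b : E a b -> E b a by rewrite !ET.
have Etrans a b c : E a b -> E b c -> E a c by rewrite !ET => ->.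
pose sepL := [exists x : A * A, ((val x.1).2 == (val x.2).2) && ~~ E x.1 x.2].
pose sepR := [exists x : A * A, ((val x.1).1 == (val x.2).1) && ~~ E x.1 x.2].
have [xL [xL2 xLE]] : exists x : A * A, (val x.1).2 = (val x.2).2 /\ (if sepL then ~~ E x.1 x.2 else x.1 == x.2).
  rewrite /sepL; case: existsP => [[x /andP[/eqP x2 nE]]|_]; first by exists x.
  by exists (a0, a0).
have [xR [xR1 xRE]] : exists x : A * A, (val x.1).1 = (val x.2).1 /\ (if sepR then ~~ E x.1 x.2 else x.1 == x.2).
  rewrite /sepR; case: existsP => [[x /andP[/eqP x2 nE]]|_]; first by exists x.
  by exists (a0, a0).
pose at_L (x u : V) : A := if u == x then xL.1 else xL.2.
pose at_R (y v : V) : A := if v == y then xR.1 else xR.2.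
pose const1 (a : A) := [ffun u : V => (val a).1]; pose const2 (a : A) := [ffun v : V => (val a).2].
pose conv (o : A + option (bool * V)) : letter P :=
  match o with
  | inl a => Some (const1 a, const2 a)
  | inr None => None
  | inr (Some (true, x)) => Some ([ffun u => (val (at_L x u)).1], const2 xL.1)
  | inr (Some (false, y)) => Some (const1 xR.1, [ffun v => (val (at_R y v)).2])
  end.
have [|||e ee eP] := PhiP (map conv T).
- by rewrite size_map.
- by apply/mapP; exists (inr None).
- rewrite all_map; apply/allP => -[a|[[[] x]|]] //= _; apply/forallP => u; apply/forallP => v;
    apply/implyP => _; rewrite !ffunE.
  + by rewrite -surjective_pairing; apply: valP.
  + have -> : (val xL.1).2 = (val (at_L x u)).2 by rewrite /at_L; case: ifP.
    by rewrite -surjective_pairing; apply: valP.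
  + have -> : (val xR.1).1 = (val (at_R x v)).1 by rewrite /at_R; case: ifP.
    by rewrite -surjective_pairing; apply: valP.
exists e => //; exists (sepL, sepR) => _ u v u' v' uv uv'; rewrite /pull !eP //=.
pose lett (x y : V) (xy : over_edge i j x y) (o : option (bool * V)) : A :=
  match o with
  | None => Sub (Some x, y) (augA _ _ xy)
  | Some (true, x0) => at_L x0 x
  | Some (false, y0) => at_R y0 y
  end.
have lettE (x y : V) (xy : over_edge i j x y) :
    [seq (act1 x k, act2 y k) | k <- map conv T] = map val (map (subst (lett x y xy)) T).
  rewrite -!map_comp; apply: eq_map => -[a|[[[] x0]|]] //=; rewrite !ffunE.
  - by rewrite -surjective_pairing.
  - have -> : (val xL.1).2 = (val (at_L x0 x)).2 by rewrite /at_L; case: ifP.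
    by rewrite -surjective_pairing.
  - have -> : (val xR.1).1 = (val (at_R x0 y)).1 by rewrite /at_R; case: ifP.
    by rewrite -surjective_pairing.
rewrite (lettE _ _ uv) (lettE _ _ uv') canon.
have [pu pv _] := uv; have [pu' pv' _] := uv'.
split=> [all_E|[eqL eqR] [[[] x]|]] /=.
- split=> [sL|sR].
    have := all_E (Some (true, u)); rewrite /= /at_L eqxx; case: eqP => // _ Exy.
    by rewrite sL Exy in xLE.
  have := all_E (Some (false, v)); rewrite /= /at_R eqxx; case: eqP => // _ Exy.
  by rewrite sR Exy in xRE.
- have [sL|nL] := boolP sepL; first by rewrite eqL.
  by move: xLE; rewrite (negbTE nL) /at_L => /eqP ->; rewrite !if_same.
- have [sR|nR] := boolP sepR; first by rewrite eqR.
  by move: xRE; rewrite (negbTE nR) /at_R => /eqP ->; rewrite !if_same.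
have sameL (a b : A) : ~~ sepL -> (val a).2 = (val b).2 -> E a b.
  move=> nL ab; apply/negPn/negP => nE; case/existsP: nL; exists (a, b).
  by rewrite /= ab eqxx.
have sameR (a b : A) : ~~ sepR -> (val a).1 = (val b).1 -> E a b.
  move=> nR ab; apply/negPn/negP => nE; case/existsP: nR; exists (a, b).
  by rewrite /= ab eqxx.
have [sL|nL] := boolP sepL; have [sR|nR] := boolP sepR.
- have [eu ev] := (eqL sL, eqR sR); subst u' v'.
  by rewrite (_ : Sub _ _ = Sub (Some u, v) (augA _ _ uv')) //; apply: val_inj.
- by apply: sameR; rewrite //= (eqL sL).
- by apply: sameL; rewrite //= (eqR sR).
(* If [E] ignores each end separately, the vertex [None], adjacent to everything over [j], connects
   any two edges: the left end is moved to [None], then the right end from [v] to [v'], then the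
   left end to [u']. *)
- apply: (Etrans _ (Sub (None, v) (augN _ pv))); first exact: sameL.
  apply: (Etrans _ (Sub (None, v') (augN _ pv'))); first exact: sameR.
  exact: sameL.
Qed.

End Stages.

(** * One pass of the partite construction *)

Lemma canonical_pattern_iff (m : nat) (F : rel 'I_m) (k k' : 'I_m -> 'I_m -> nat) :
  (forall i j i' j' : 'I_m, i < j -> i' < j' -> F i j -> F i' j' ->
     k i j = k i' j' <-> k' i j = k' i' j') ->
  canonical_pattern F k -> canonical_pattern F k'.
Proof.
move=> kk [] h; [constructor 1 | constructor 2 | constructor 3 | constructor 4];
  move=> i j i' j' ij ij' Fij Fij'; have := h i j i' j' ij ij' Fij Fij'; rewrite kk //.
Qed.

(** The finite colouring [tau] is what the next pass uses to give the edges of a copy in the base a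
    common type. *)
Definition canonical_ramsey (m : nat) (F : rel 'I_m) (V : finType) (cop : {set {ffun 'I_m -> V}})
    (C : finType) :=
  forall (phi : V -> V -> nat) (tau : V -> V -> C), exists2 c, c \in cop &
    canonical_pattern F (fun i j => phi (c i) (c j)) /\
    forall i j i' j' : 'I_m, i < j -> i' < j' -> F i j -> F i' j' ->
      tau (c i) (c j) = tau (c i') (c j').

Section Pass.
Variables (m : nat) (F : rel 'I_m) (w n : nat).
Variables (W : finType) (hadj : rel W) (hcop : {set {ffun 'I_m -> W}}) (lev : W -> nat).
Hypothesis F_sym : symmetric F.
Hypothesis F_cliques : cliques_bounded F w.
Hypothesis w_gt1 : 1 < w.
Hypothesis hadj_sym : symmetric hadj.
Hypothesis hadj_lev : forall x y, hadj x y -> lev x != lev y.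
Hypothesis hcop_lev : forall c, c \in hcop -> forall i j : 'I_m, i < j -> lev (c i) < lev (c j).
Hypothesis hcop_hom : forall c, c \in hcop -> forall i j, F i j -> hadj (c i) (c j).
Local Notation pic := (picture F w n hadj hcop).

Let hadj_irr : irreflexive hadj.
Proof. by move=> x; apply/negP => /hadj_lev; rewrite eqxx. Qed.

Let hcop_inj c : c \in hcop -> injective c.
Proof.
move=> cH i j eq_c; case: (ltngtP i j) => [|| /val_inj //] /(hcop_lev cH);
  by rewrite eq_c ltnn.
Qed.

Section Initial.
Let V : finType := ({ffun 'I_m -> W} * 'I_m)%type.
Let adj (x y : V) := [&& x.1 == y.1, x.1 \in hcop & F x.2 y.2].
Let pr (x : V) : W := x.1 x.2.
Let cop : {set {ffun 'I_m -> V}} := [set [ffun i => (c, i)] | c : {ffun 'I_m -> W} in hcop].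

Let copP c : c \in cop -> exists2 A, A \in hcop & c = [ffun i => (A, i)].
Proof. by case/imsetP => A AH ->; exists A. Qed.

Let adj_sym : symmetric adj.
Proof.
move=> [A i] [B j]; rewrite /adj /= eq_sym F_sym.
by case: eqP => //= ->.
Qed.

Let adj_hom x y : adj x y -> hadj (pr x) (pr y).
Proof. by case: x y => [A i] [B j] /and3P[/= /eqP<- AH Fij]; apply: hcop_hom. Qed.

Let cop_proj c : c \in cop -> [ffun i => pr (c i)] \in hcop.
Proof.
case/copP => A AH ->; suff -> : [ffun i => pr ([ffun i => (A, i)] i)] = A by [].
by apply/ffunP => i; rewrite !ffunE.
Qed.

Let cop_ind : copies_induced F adj cop.
Proof. by move=> _ /copP[A AH ->] i j; rewrite !ffunE /adj /= eqxx AH. Qed.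

Let adj_F x y : adj x y -> F x.2 y.2. Proof. by case/and3P. Qed.

Let cliques : cliques_bounded adj w.
Proof.
move=> s ps; rewrite -(size_map snd); apply: F_cliques; rewrite pairwise_map.
by apply: sub_pairwise ps => x y; apply: adj_F.
Qed.

Let clean : copies_clean F cop.
Proof.
move=> _ _ /copP[A AH ->] /copP[B BH ->] ne i j k l _; rewrite !ffunE => -[AB].
by rewrite AB eqxx in ne.
Qed.

Let near : copies_near_induced F adj cop n.+1.
Proof.
move=> _ /copP[A AH ->] i j s ps _ _; right; exists (map snd s).
rewrite ffunE in ps; have -> : i = (A, i).2 by [].
split; first by rewrite path_map; apply: sub_path ps => x y; apply: adj_F.
elim: s i ps => //= -[B k] s IHs i /andP[/and3P[/= /eqP<- _ _] ps].
by rewrite ffunE -(IHs k).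
Qed.

Let odd_walks : odd_walks_bounded F adj n.+1.*2.
Proof.
move=> s cs os _; exists (map snd s); rewrite size_map os leqnn.
by split=> //; rewrite cycle_map; apply: sub_cycle cs => x y; apply: adj_F.
Qed.

Lemma initial_picture : exists P : pic, forall A, A \in hcop ->
  exists2 c0, c0 \in pcop P & forall i, proj (c0 i) = A i.
Proof.
exists (@Picture m F w n W hadj hcop V adj pr cop adj_sym adj_hom cop_proj cop_ind cliques
    (fun _ => And3 clean near odd_walks)) => A AH.
by exists [ffun i => (A, i)]; [apply/imsetP; exists A | move=> i; rewrite ffunE].
Qed.
End Initial.

(** The types [t] become known only after the two Hales-Jewett stages have been undone, so the fan
    and vertex stages are prepared for every [t]. *)
Lemma canonical_pass (C : finType) :
  canonical_ramsey F hcop (option C * (bool * bool))%type ->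
  exists Q : pic, canonical_ramsey F (pcop Q) C.
Proof.
move=> ramH; have [P0 initial_copy] := initial_picture.
have tyP := @typed_pull m F w n W hadj hcop.
have [Q1 fans] := @iterate_stages m F w n W hadj hcop nat (W -> W -> bool * bool) (W * W)%type
  (fun t P phi => all_typed lev t phi) (fun ij t P phi => disjoint_palettes lev ij t phi)
  (fun t P Q e phi ee ty i j hij => tyP _ _ _ _ _ _ _ _ _ ee (ty i j hij))
  (fun ij t P Q e phi ee dis hij i' j' h' sep u v u' v' o o' =>
     dis hij i' j' h' sep _ _ _ _ (over_edge_emb ee o) (over_edge_emb ee o'))
  (fan_step lev w_gt1 hadj_sym hadj_irr hcop_inj) (enum {: W * W}) P0.
have [|Q2 vertices] := @iterate_stages m F w n W hadj hcop nat (W -> W -> bool * bool) W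
  (fun t P phi => all_typed lev t phi) (fun i t P phi => uniform_vertices lev i t phi)
  (fun t P Q e phi ee ty i j hij => tyP _ _ _ _ _ _ _ _ _ ee (ty i j hij)) _
  (vertex_step lev w_gt1 hadj_sym hadj_irr hcop_inj) (enum W) Q1.
  move=> i t P Q e phi ee [r [r' [hr hr']]]; exists r, r'; split.
    by move=> k k' u v v' h h' tk tk' /(over_edge_emb ee) o /(over_edge_emb ee) o'; apply: hr o o'.
  by move=> k k' u v v' h h' tk tk' /(over_edge_emb ee) o /(over_edge_emb ee) o'; apply: hr' o o'.
have [||Q3 types] := @iterate_stages m F w n W hadj hcop nat unit (W * W)%type
  (fun _ P phi => True) (fun ij _ P phi => some_type lev ij phi) (fun _ _ _ _ _ _ _ => I) _
  _ (enum {: W * W}) Q2.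
  by move=> ij _ P Q e phi ee [ab ty]; exists ab => hij; apply: tyP ee (ty hij).
  by move=> ij P; have [Q tQ] := type_step lev w_gt1 hadj_sym hadj_irr hcop_inj ij P; exists Q => _ phi _; apply: tQ.
have [|Q4 unif] := @iterate_stages m F w n W hadj hcop C unit (W * W)%type
  (fun _ P phi => True) (fun ij _ P tau => pairs_uniform lev ij tau) (fun _ _ _ _ _ _ _ => I)
  (fun ij _ P Q e phi ee ty hij => tyP _ _ _ _ _ _ _ _ _ ee (ty hij)) _ (enum {: W * W}) Q3.
  by move=> ij P; have [Q tQ] := uniform_step lev w_gt1 hadj_sym hadj_irr hcop_inj C ij P; exists Q => _ phi _; apply: tQ.
exists Q4 => phi tau.
have [e4 ee4 unif4] := unif tt tau I.
have [e3 ee3 types3] := types tt (pull e4 phi) I.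
have [|t0 t0P] := fin_all_exists (P := fun ij ab => hedge hadj lev ij.1 ij.2 ->
    typed ab.1 ab.2 ij.1 ij.2 (pull e3 (pull e4 phi))).
  by move=> ij; apply: types3; rewrite mem_enum.
pose t i j := t0 (i, j).
have ty2 : all_typed lev t (pull e3 (pull e4 phi)) by move=> i j; apply: (t0P (i, j)).
have [e2 ee2 vert2] := vertices t _ ty2.
have ty1 : all_typed lev t (pull e2 (pull e3 (pull e4 phi))).
  by move=> i j hij; apply: typed_pull ee2 (ty2 i j hij).
have [e1 ee1 fans1] := fans t _ ty1.
pose f := e4 \o (e3 \o (e2 \o e1)).
have ef : embedding f by do 3![apply: embedding_comp => //].
pose phi0 := pull f phi; pose tau0 := pull f tau.
have ty0 : all_typed lev t phi0 by move=> i j hij; apply: typed_pull ee1 (ty1 i j hij).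
have tau0P i j : hedge hadj lev i j -> typed false false i j tau0.
  move=> hij; have := unif4 (i, j); rewrite mem_enum => /(_ isT hij).
  by apply: typed_pull; do 2![apply: embedding_comp => //].
have {}fans1 i j i' j' : hedge hadj lev i j -> hedge hadj lev i' j' -> separated t i j i' j' ->
    forall u v u' v', over_edge i j u v -> over_edge i' j' u' v' -> phi0 u v <> phi0 u' v'.
  by move=> hij hij' sep; apply: (fans1 (i, j)); rewrite ?mem_enum.
have [|r rP] := fin_all_exists (P := fun i rr =>
    (forall k k' u v v', hedge hadj lev i k -> hedge hadj lev i k' ->
      t i k = (true, false) -> t i k' = (true, false) ->
      over_edge i k u v -> over_edge i k' u v' -> phi0 u v = phi0 u v' <-> rr.1 k = rr.1 k' :> nat) /\
    (forall k k' u v v', hedge hadj lev k i -> hedge hadj lev k' i ->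
      t k i = (false, true) -> t k' i = (false, true) ->
      over_edge k i v u -> over_edge k' i v' u -> phi0 v u = phi0 v' u <-> rr.2 k = rr.2 k' :> nat)).
  move=> i; have [|r [r' [hr hr']]] := vert2 i; first by rewrite mem_enum.
  exists (r, r'); split=> k k' u v v' h h' tk tk' o o'.
    exact: (hr _ _ _ _ _ h h' tk tk' (over_edge_emb ee1 o) (over_edge_emb ee1 o')).
  exact: (hr' _ _ _ _ _ h h' tk tk' (over_edge_emb ee1 o) (over_edge_emb ee1 o')).
pose over_ij i j (uv : pvert P0 * pvert P0) := [&& proj uv.1 == i, proj uv.2 == j & padj uv.1 uv.2].
(* the colouring of the base that is canonical on A iff phi0 is canonical over A *)
pose code i j : nat :=
  match t i j with
  | (false, false) => if [pick uv | over_ij i j uv] is Some uv then phi0 uv.1 uv.2 else 0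
  | (true, false) => pickle (i, (r i).1 j)
  | (false, true) => pickle (j, (r j).2 i)
  | (true, true) => pickle (i, j)
  end.
(* Constancy of [tcode] on a copy gives both the constancy of [tau0] over it and a common type of
   its edges. *)
pose tcode i j := (if [pick uv | over_ij i j uv] is Some uv then Some (tau0 uv.1 uv.2) else None, t i j).
have [A AH [canA tauA]] := ramH code tcode.
have [c0 c0P c0A] := initial_copy A AH.
have [_ _ _ /(_ _ c0P) fP] := ef.
exists [ffun i => f (c0 i)] => //.
have c0_edge i j : F i j -> over_edge (A i) (A j) (c0 i) (c0 j).
  by move=> Fij; split; rewrite ?c0A // (pcop_ind c0P).
have A_edge (i j : 'I_m) : i < j -> F i j -> hedge hadj lev (A i) (A j).
  by move=> ij Fij; rewrite /hedge hcop_hom ?hcop_lev.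
have pickE i j : F i j -> exists2 uv, [pick uv | over_ij (A i) (A j) uv] = Some uv &
    over_edge (A i) (A j) uv.1 uv.2.
  move=> Fij; case: pickP => [uv /and3P[/eqP pu /eqP pv uv_adj]|/(_ (c0 i, c0 j))]; first by exists uv.
  by have [pu pv uv_adj] := c0_edge i j Fij; rewrite /over_ij /= pu pv uv_adj !eqxx.
split; last first.
  move=> i j i' j' ij ij' Fij Fij'; rewrite !ffunE.
  have := tauA i j i' j' ij ij' Fij Fij'; rewrite /tcode.
  have [uv -> o] := pickE i j Fij; have [uv' -> o'] := pickE i' j' Fij' => -[e _].
  have eq1 : tau0 uv.1 uv.2 = tau0 (c0 i) (c0 j).
    by apply/(tau0P _ _ (A_edge i j ij Fij) _ _ _ _ o (c0_edge i j Fij)).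
  have eq2 : tau0 uv'.1 uv'.2 = tau0 (c0 i') (c0 j').
    by apply/(tau0P _ _ (A_edge i' j' ij' Fij') _ _ _ _ o' (c0_edge i' j' Fij')).
  by rewrite eq1 eq2 in e; case: e.
apply: canonical_pattern_iff canA => i j i' j' ij ij' Fij Fij'.
rewrite !ffunE -/(phi0 (c0 i) (c0 j)) -/(phi0 (c0 i') (c0 j')).
have [h h'] := (A_edge i j ij Fij, A_edge i' j' ij' Fij').
have [o o'] := (c0_edge i j Fij, c0_edge i' j' Fij').
have tt' : t (A i) (A j) = t (A i') (A j').
  exact: (congr1 snd (tauA i j i' j' ij ij' Fij Fij')).
have Aeq x y : (A x = A y) <-> x = y by split=> [/(hcop_inj AH)|->].
have A_notin x y z : z != x -> z != y -> A z \notin [:: A x; A y].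
  by move=> zx zy; rewrite !inE !(inj_eq (hcop_inj AH)) negb_or zx zy.
have differ (x y x' y' : 'I_m) : x < y -> x' < y' -> F x y -> F x' y' ->
    separated t (A x) (A y) (A x') (A y') -> phi0 (c0 x) (c0 y) <> phi0 (c0 x') (c0 y').
  move=> xy xy' Fxy Fxy' sep.
  exact: (fans1 _ _ _ _ (A_edge x y xy Fxy) (A_edge x' y' xy' Fxy') sep _ _ _ _ (c0_edge x y Fxy) (c0_edge x' y' Fxy')).
rewrite /code -tt'; case tE: (t (A i) (A j)) => [[] []]; rewrite tE in tt'.
- split=> [/(pcan_inj pickleK)[/Aeq -> /Aeq ->] //|e].
  (* An end of [i'j'] off [i] and [j] would separate the colours. Hence both ends are among [i],
     [j], and their order forces equality. *)
  have inP (x : 'I_m) : (t (A i') (A j')).1 -> (t (A i') (A j')).2 ->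
      (x == i') || (x == j') -> (x == i) || (x == j).
    move=> t1 t2 x_in; apply/negPn/negP; rewrite negb_or => /andP[xi xj].
    case: (differ i j i' j' ij ij' Fij Fij') => //; rewrite /separated t1 t2 /=.
    by case/orP: x_in => /eqP ex; rewrite -ex (A_notin _ _ x) ?orbT.
  have [/=] := (inP i', inP j'); rewrite -tt' !eqxx !orbT => /(_ isT isT isT) i'in /(_ isT isT isT).
  case/orP: i'in => /eqP ei; case/orP=> /eqP ej; subst i' j' => //; exfalso.
  + by rewrite ltnn in ij'.
  + by move: (ltn_trans ij ij'); rewrite ltnn.
  + by rewrite ltnn in ij'.
- have [ei|ni] := eqVneq i i'.
    subst i'; have [rmin _] := rP (A i).
    apply: iff_sym; apply: iff_trans (rmin _ _ _ _ _ h h' tE (esym tt') o o') _.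
    by split=> [->|/(pcan_inj pickleK)[]].
  split=> [/(pcan_inj pickleK)[/Aeq ei]|e]; first by rewrite ei eqxx in ni.
  (* If [i'] is [j], then [i'j'] is not separated from [ij]; but [i] lies off [i'j'], so the roles
     are exchanged. *)
  exfalso; have [eij|nij] := eqVneq i' j.
    apply: (differ i' j' i j ij' ij Fij' Fij) => //; rewrite /separated tE /= A_notin //.
    by apply: contraTneq ij => ei; rewrite ei -eij -leqNgt ltnW.
  by apply: (differ i j i' j' ij ij' Fij Fij') => //; rewrite /separated -tt' /= A_notin // eq_sym.
- have [ej|nj] := eqVneq j j'.
    subst j'; have [_ rmax] := rP (A j).
    apply: iff_sym; apply: iff_trans (rmax _ _ _ _ _ h h' tE (esym tt') o o') _.
    by split=> [->|/(pcan_inj pickleK)[]].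
  split=> [/(pcan_inj pickleK)[/Aeq ej]|e]; first by rewrite ej eqxx in nj.
  exfalso; have [eij|nij] := eqVneq j' i.
    apply: (differ i' j' i j ij' ij Fij' Fij) => //; rewrite /separated tE /= A_notin //.
    by apply: contraTneq ij => ej; rewrite ej -leqNgt -eij ltnW.
  by apply: (differ i j i' j' ij ij' Fij Fij') => //; rewrite /separated -tt' /= A_notin // eq_sym.
- have [uv -> ouv] := pickE i j Fij; have [uv' -> ouv'] := pickE i' j' Fij'.
  have := ty0 _ _ h; rewrite tE => /(_ _ _ _ _ ouv o) [_ /(_ (conj _ _)) ->] //.
  by have := ty0 _ _ h'; rewrite -tt' => /(_ _ _ _ _ ouv' o') [_ /(_ (conj _ _)) ->].
Qed.
End Pass.

(** * Iterating the construction *)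

Section Systems.
Variables (m : nat) (F : rel 'I_m) (w : nat).
Hypothesis F_sym : symmetric F.
Hypothesis F_irr : irreflexive F.
Hypothesis F_cliques : cliques_bounded F w.
Hypothesis w_gt1 : 1 < w.

(** [lev] orders the vertices only up to ties. These never occur between adjacent vertices or within
    a copy, so they can be broken arbitrarily at the end. *)
Record conform_system (n : nat) (V : finType) (adj : rel V) (cop : {set {ffun 'I_m -> V}})
    (lev : V -> nat) : Prop := ConformSystem {
  cs_sym : symmetric adj;
  cs_lev : forall x y, adj x y -> lev x != lev y;
  cs_cop_lev : forall c, c \in cop -> forall i j : 'I_m, i < j -> lev (c i) < lev (c j);
  cs_ind : copies_induced F adj cop;
  cs_cliques : cliques_bounded adj w;
  cs_near : copies_near_induced F adj cop n;
  cs_odd : odd_walks_bounded F adj n.*2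
}.

Lemma picture_system (n n' : nat) (W : finType) (hadj : rel W) (hcop : {set {ffun 'I_m -> W}})
    (lev : W -> nat) (Q : picture F w n hadj hcop) :
  (forall x y, hadj x y -> lev x != lev y) ->
  (forall c, c \in hcop -> forall i j : 'I_m, i < j -> lev (c i) < lev (c j)) ->
  copies_near_induced F (@padj _ _ _ _ _ _ _ Q) (pcop Q) n' ->
  odd_walks_bounded F (@padj _ _ _ _ _ _ _ Q) n'.*2 ->
  conform_system n' (@padj _ _ _ _ _ _ _ Q) (pcop Q) (lev \o @proj _ _ _ _ _ _ _ Q).
Proof.
move=> hlev hcl near odd_w; split=> //.
- exact: padj_sym.
- by move=> x y /padj_hom/hlev.
- by move=> c /pcop_proj/hcl h i j /h; rewrite !ffunE.
- exact: pcop_ind.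
- exact: p_cliques.
Qed.

(** Level 1 only concerns walks of length at most 1 and loops, so it follows from the copies being
    induced and from irreflexivity, without any conformity of the complete base. *)
Lemma base_system (C : finType) : exists V adj cop lev,
  @conform_system 1 V adj cop lev /\ canonical_ramsey F cop C.
Proof.
have [N er] := erdos_rado F (option C * (bool * bool))%type.
pose hadj : rel 'I_N := fun x y => x != y.
pose hcop := [set c : {ffun 'I_m -> 'I_N} | [forall i : 'I_m, forall j : 'I_m, (i < j) ==> (c i < c j)]].
have hcopP c : c \in hcop -> forall i j : 'I_m, i < j -> val (c i) < val (c j).
  by rewrite inE => /forallP h i j ij; have /forallP/(_ j)/implyP := h i; apply.
have hlev x y : hadj x y -> val x != val y by rewrite val_eqE.
have [|c cH i j Fij||Q ramQ] := @canonical_pass m F w 0 'I_N hadj hcop val F_sym F_cliques w_gt1 _ hlev hcopP _ C.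
- by move=> x y; rewrite /hadj eq_sym.
- have : i != j by apply: contraTneq Fij => ->; rewrite F_irr.
  rewrite neq_ltn => /orP[] /(hcopP c cH); rewrite /hadj -val_eqE.
    by move=> h; rewrite ltn_eqF.
  by move=> h; rewrite gtn_eqF.
- move=> phi tau; have [c [cinc canc tauc]] := er phi tau; exists [ffun i => c i].
    by rewrite inE; apply/forallP => i; apply/forallP => j; apply/implyP; rewrite !ffunE; apply: cinc.
  split=> [|i j i' j' ij ij' _ _]; last by rewrite !ffunE; apply: tauc.
  by apply: canonical_pattern_iff canc => i j i' j' _ _ _ _; rewrite !ffunE.
exists (pvert Q), (@padj _ _ _ _ _ _ _ Q), (pcop Q), (val \o @proj _ _ _ _ _ _ _ Q); split=> //.
apply: picture_system => //.
- move=> c cQ i j [|x [|//]] /=; first by right; exists [::].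
  rewrite andbT => cx ex _; rewrite ex in cx *; right; exists [:: j]; rewrite /= andbT.
  by rewrite -(pcop_ind cQ).
- move=> [|x [|y [|//]]] //= /andP[xx _] _ _.
  by have := hlev _ _ (padj_hom xx); rewrite eqxx.
Qed.

Lemma system_pass (n : nat) (V : finType) (adj : rel V) cop lev (C : finType) :
  @conform_system n V adj cop lev -> canonical_ramsey F cop (option C * (bool * bool))%type ->
  exists V' adj' cop' lev', @conform_system n.+1 V' adj' cop' lev' /\
    canonical_ramsey F cop' C /\ copies_clean F cop'.
Proof.
move=> [sym hlev hcl ind cl near odd_w] ram.
have [|Q ramQ] := @canonical_pass m F w n V adj cop lev F_sym F_cliques w_gt1 sym hlev hcl _ C ram.
  by move=> c /ind h i j; rewrite h.
have [clean near' odd'] := p_conform Q (And3 ind near odd_w).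
exists (pvert Q), (@padj _ _ _ _ _ _ _ Q), (pcop Q), (lev \o @proj _ _ _ _ _ _ _ Q).
by split; [apply: picture_system | split].
Qed.

(** The induction is over all [C] at once, as the preceding system must handle the larger colour set
    that the pass spends. *)
Lemma conform_system_exists (n : nat) (C : finType) : 0 < n -> exists V adj cop lev,
  @conform_system n V adj cop lev /\ canonical_ramsey F cop C.
Proof.
elim: n C => // -[|n] IHn C _; first exact: base_system.
have [//|V [adj [cop [lev [sys ram]]]]] := IHn (option C * (bool * bool))%type.
have [V' [adj' [cop' [lev' [sys' [ram' _]]]]]] := system_pass sys ram.
by exists V', adj', cop', lev'.
Qed.

(** A last pass over a base with induced copies provides clean intersections. Vertices are then
    renamed by their position in a list sorted by level, which turns levels into a linear order. *)
Theorem conform_ramsey_system (n : nat) : 0 < n ->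
  exists (N : nat) (adj : rel 'I_N) (cop : {set {ffun 'I_m -> 'I_N}}),
    conform_system n.+1 adj cop val /\ copies_clean F cop /\ canonical_ramsey F cop unit.
Proof.
move=> n_gt0; have [V0 [adj0 [cop0 [lev0 [sys0 ram0]]]]] :=
  conform_system_exists (option unit * (bool * bool))%type n_gt0.
have [V [adj [cop [lev [sys [ram clean]]]]]] := system_pass sys0 ram0.
have [sym hlev hcl ind cl near odd_w] := sys.
pose le x y := lev x <= lev y; pose s := sort le (enum V).
have sort_s : sorted le s by apply: sort_sorted => x y; apply: leq_total.
have s_size : size s = #|V| by rewrite size_sort -cardE.
have s_uniq : uniq s by rewrite sort_uniq enum_uniq.
have s_in x : x \in s by rewrite mem_sort mem_enum.
have lt_index x : index x s < #|V| by rewrite -s_size index_mem.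
pose g x : 'I_#|V| := Ordinal (lt_index x).
pose f (a : 'I_#|V|) : V := nth (enum_val a) s a.
have gK x : f (g x) = x by rewrite /f nth_index.
have fK a : g (f a) = a by apply: val_inj; rewrite /= index_uniq // s_size.
have f_inj : injective f by apply: can_inj fK.
have g_lev x y : lev x < lev y -> g x < g y.
  move=> xy; rewrite ltnNge; apply: contraL xy => le_yx; rewrite -leqNgt.
  rewrite -(gK x) -(gK y) /f (set_nth_default (enum_val (g x)) (enum_val (g y))) ?s_size //.
  have le_tr : transitive le by move=> a b c; apply: leq_trans.
  have le_refl : reflexive le by move=> a; apply: leqnn.
  by apply: (sorted_leq_nth le_tr le_refl (enum_val (g x)) sort_s) => //; rewrite inE s_size.
pose adj' : rel 'I_#|V| := fun a b => adj (f a) (f b).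
pose cop' := [set [ffun i => g (c i)] | c : {ffun 'I_m -> V} in cop].
have cop'P c' : c' \in cop' -> exists2 c, c \in cop & forall i, f (c' i) = c i.
  by case/imsetP => c cP ->; exists c => // i; rewrite ffunE gK.
exists #|V|, adj', cop'; split; [split | split].
- by move=> x y; rewrite /adj' sym.
- by move=> x y /hlev; apply: contraNneq => /val_inj ->.
- move=> _ /imsetP[c cP ->] i j ij; rewrite !ffunE; apply: g_lev; exact: hcl.
- by move=> c' /cop'P[c cP cE] i j; rewrite /adj' !cE ind.
- move=> t pt; rewrite -(size_map f); apply: cl; rewrite pairwise_map.
  exact: sub_pairwise pt.
- move=> c' /cop'P[c cP cE] i j t pt lt st.
  have pft : path adj (c i) (map f t) by rewrite -cE path_map.
  have [|||[t' ht']|[t' [pt' et']]] := near c cP i j (map f t) => //.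
  + by rewrite -!cE last_map lt.
  + by rewrite size_map.
  + by left; exists t'; rewrite size_map in ht'.
  right; exists t'; split=> //; apply: (inj_map f_inj); rewrite et' -map_comp.
  by apply: eq_map => k /=; rewrite cE.
- move=> t ct ot st; have [||| t' ht'] := odd_w (map f t); rewrite ?size_map //.
    by rewrite cycle_map.
  by exists t'; rewrite size_map in ht'.
- move=> c' d' /imsetP[c cP ->] /imsetP[d dP ->] ne i j k l ik.
  rewrite !ffunE => /(can_inj gK) ej /(can_inj gK) ek.
  have cd : c != d by apply: contraNneq ne => ->.
  have [Fik two] := clean _ _ cP dP cd _ _ _ _ ik ej ek; split=> // p q.
  by rewrite !ffunE => /(can_inj gK)/two.
- move=> phi tau; have [c cP [can tauP]] := ram (fun x y => phi (g x) (g y)) (fun x y => tau (g x) (g y)).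
  exists [ffun i => g (c i)]; first by apply/imsetP; exists c.
  split=> [|i j i' j' ij ij' Fij Fij']; last by rewrite !ffunE; apply: tauP.
  by apply: canonical_pattern_iff can => i j i' j' _ _ _ _; rewrite !ffunE.
Qed.
End Systems.

(** * Graphs from systems of maps *)

Import Order.TTheory.

Section GraphFacts.
Variable T : finType.
Implicit Types (G : graph T) (x y : T).

Lemma edge_card G e : e \in edges G -> #|e| = 2.
Proof. by move=> eE; have /forall_inP/(_ e eE)/andP[/eqP] := graph_valP G. Qed.

Lemma edge_sub G e : e \in edges G -> e \subset verts G.
Proof. by move=> eE; have /forall_inP/(_ e eE)/andP[] := graph_valP G. Qed.

Lemma adj_sym G : symmetric (adj G).
Proof. by move=> x y; rewrite /adj setUC. Qed.

Lemma adj_irr G : irreflexive (adj G).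
Proof. by move=> x; apply/negP => /edge_card; rewrite setUid cards1. Qed.

Lemma edgeP G e : e \in edges G -> exists x y, [/\ x != y, e = [set x; y] & adj G x y].
Proof.
move=> eE; have /eqP/cards2P[x [y [xy ee]]] := edge_card eE.
by exists x, y; rewrite /adj -ee.
Qed.

Lemma set2_inj x y a b : [set x; y] = [set a; b] :> {set T} ->
  (x = a /\ y = b) \/ (x = b /\ y = a).
Proof.
move=> e; have : x \in [set a; b] by rewrite -e set21.
have : y \in [set a; b] by rewrite -e set22.
have : a \in [set x; y] by rewrite e set21.
have : b \in [set x; y] by rewrite e set22.
by rewrite !inE => /orP[]/eqP eb /orP[]/eqP ea /orP[]/eqP ey /orP[]/eqP ex; subst; auto.
Qed.

Section MakeGraph.
Variables (A : {set T}) (r : rel T).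
Hypothesis r_sym : symmetric r.
Hypothesis r_irr : irreflexive r.
Hypothesis r_sub : forall x y, r x y -> x \in A.

Let E := [set [set p.1; p.2] | p : T * T in [set p | r p.1 p.2]].

Let E_axiom : graph_axiom (A, E).
Proof.
apply/forall_inP => _ /imsetP[[x y] + ->]; rewrite inE /= => rxy.
have ryx : r y x by rewrite r_sym.
rewrite subUset !sub1set (r_sub rxy) (r_sub ryx) cards2 (_ : x != y) //.
by apply: contraTneq rxy => ->; rewrite r_irr.
Qed.

Definition mk_graph : graph T := Graph E_axiom.

Lemma adj_mk_graph : adj mk_graph =2 r.
Proof.
move=> x y; apply/imsetP/idP => [[[a b]]|rxy]; last by exists (x, y); rewrite ?inE.
by rewrite inE /= => rab /set2_inj[[-> ->]|[-> ->]] //; rewrite r_sym.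
Qed.

End MakeGraph.
End GraphFacts.

Section Least.
Variables (N : nat) (P : pred nat).

Lemma least_le k : P k -> k <= N -> exists2 k', least N P = Some k' & k' <= k.
Proof.
move=> Pk kN; rewrite /least; have ks : k \in [seq k <- iota 0 N.+1 | P k].
  by rewrite mem_filter Pk mem_iota.
have : sorted leq [seq k <- iota 0 N.+1 | P k].
  by apply: sorted_filter (iota_sorted _ _); apply: leq_trans.
case: (filter _ _) ks => //= h t kht path_t; exists h => //.
move: kht; rewrite inE => /predU1P[-> //|kt].
by have /allP/(_ k kt) := order_path_min leq_trans path_t.
Qed.

Lemma least_Some k : least N P = Some k -> P k.
Proof.
rewrite /least => e; have : k \in [seq k <- iota 0 N.+1 | P k].
  by case: (filter _ _) e => //= h t [->]; rewrite mem_head.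
by rewrite mem_filter => /andP[].
Qed.
End Least.

(** * Transfer between ordered graphs and indexed copies *)

Section Conversion.
Variables (d : Order.disp_t) (T : finOrderType d) (F : graph T).
Local Notation m := #|verts F|.

Definition vert (i : 'I_m) : T := Order.enum_val i.
Definition index_adj : rel 'I_m := fun i j => adj F (vert i) (vert j).

Lemma vert_in i : vert i \in verts F. Proof. exact: Order.EnumVal.enum_valP. Qed.

Lemma vert_inj : injective vert. Proof. exact: Order.EnumVal.enum_val_inj. Qed.

Lemma vertP x : x \in verts F -> exists i, x = vert i.
Proof. by move=> xF; exists (Order.enum_rank_in xF x); rewrite /vert Order.EnumVal.enum_rankK_in. Qed.

Lemma le_vert i j : (vert i <= vert j)%O = (i <= j).
Proof. by rewrite /vert Order.le_enum_val. Qed.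

Lemma index_adj_sym : symmetric index_adj. Proof. by move=> i j; apply: adj_sym. Qed.
Lemma index_adj_irr : irreflexive index_adj. Proof. by move=> i; apply: adj_irr. Qed.

Lemma index_cliques : cliques_bounded index_adj (clique_number F).
Proof.
move=> s ps.
have us : uniq s.
  elim: s ps => //= i s IHs /andP[/allP is_ ps]; rewrite IHs // andbT.
  by apply/negP => /is_; rewrite index_adj_irr.
have adj_in i j : i \in s -> j \in s -> i != j -> index_adj i j.
  elim: s ps {us} => //= k s IHs /andP[/allP ks ps]; rewrite !inE.
  move=> /predU1P[->|is_] /predU1P[->|js]; first by rewrite eqxx.
  - by move=> _; apply: ks.
  - by move=> _; rewrite index_adj_sym; apply: ks.
  - exact: IHs.
have cl : clique F [set vert i | i in s].
  apply/andP; split; first by apply/subsetP => _ /imsetP[i _ ->]; apply: vert_in.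
  apply/forall_inP => _ /imsetP[i is_ ->]; apply/forall_inP => _ /imsetP[j js ->].
  by apply/implyP; rewrite (inj_eq vert_inj); apply: adj_in.
have -> : size s = #|[set vert i | i in s]| by rewrite (card_imset _ vert_inj); apply/esym/card_uniqP.
exact: (@leq_bigmax_cond _ (clique F) (fun K : {set T} => #|K|) _ cl).
Qed.

(** Repeated splitting at repeated vertices ends in an odd cycle that is no longer than the walk. *)
Lemma odd_walk_girth s : cycle index_adj s -> odd (size s) ->
  exists2 k, odd_girth F = Some k & k <= size s.
Proof.
have [k] := ubnP (size s); elim: k s => // k IH s; rewrite ltnS => le_s cs os.
have [us|nus] := boolP (uniq s); last first.
  have [s' [cs' os' lt_s]] := odd_cycle_split cs os nus.
  have lt_s' : size s' < size s by rewrite (leq_trans _ lt_s) // addn2.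
  have [k' ek kl] := IH s' (leq_trans lt_s' le_s) cs' os'.
  by exists k' => //; apply: leq_trans kl (ltnW lt_s').
apply: least_le.
  rewrite os; apply/existsP; exists (map_tuple vert (in_tuple s)).
  rewrite /is_cycle size_map /ucycleb map_inj_uniq ?us; last exact: vert_inj.
  rewrite cycle_map andbT; apply/andP; split; last exact: cs.
  case: s cs os {us le_s} => [|x [|y []]] //=.
  by rewrite index_adj_irr.
by rewrite -(card_uniqP us) -[X in _ <= X]card_ord max_card.
Qed.

Section System.
Variables (n N : nat) (r : rel 'I_N) (cop : {set {ffun 'I_m -> 'I_N}}).
Hypothesis sys : conform_system index_adj (clique_number F) n.+1 r cop val.
Hypothesis cop_clean : copies_clean index_adj cop.

Let r_sym : symmetric r := cs_sym sys.
Let r_irr : irreflexive r.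
Proof. by move=> x; apply/negP => /(cs_lev sys); rewrite eqxx. Qed.

Definition system_graph : graph 'I_N := mk_graph r_sym r_irr (fun x y _ => in_setT x).
Local Notation H := system_graph.

(** The conjunct [x != y] makes the relation irreflexive also for non-injective [c], so that
    [copy_graph] is defined for every function. *)
Definition copy_adj (c : {ffun 'I_m -> 'I_N}) : rel 'I_N := fun x y =>
  (x != y) && [exists i, exists j, [&& x == c i, y == c j & index_adj i j]].

Let copy_adj_sym c : symmetric (copy_adj c).
Proof.
move=> x y; rewrite /copy_adj eq_sym; congr (_ && _).
by apply/existsP/existsP => -[i /existsP[j /and3P[xi yj ij]]]; exists j; apply/existsP; exists i;
  rewrite xi yj index_adj_sym.
Qed.

Let copy_adj_irr c : irreflexive (copy_adj c).
Proof. by move=> x; rewrite /copy_adj eqxx. Qed.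

Let copy_adj_sub c x y : copy_adj c x y -> x \in c @: setT.
Proof. by case/andP => _ /existsP[i /existsP[j /and3P[/eqP -> _ _]]]; apply: imset_f. Qed.

Definition copy_graph c : graph 'I_N :=
  mk_graph (@copy_adj_sym c) (@copy_adj_irr c) (@copy_adj_sub c).

Definition copy_graphs : {set graph 'I_N} := [set copy_graph c | c in cop].

Let cop_mono c : c \in cop -> forall i j, (c i <= c j) = (i <= j).
Proof.
move=> cP i j; case: (ltngtP i j) => [ij|ij|/val_inj->]; last exact: leqnn.
  exact/ltnW/(cs_cop_lev sys cP).
by apply/negbTE; rewrite -ltnNge; apply: (cs_cop_lev sys cP).
Qed.

Let cop_inj c : c \in cop -> injective c.
Proof.
move=> cP i j e; apply/val_inj/anti_leq; by rewrite -!(cop_mono cP) e leqnn.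
Qed.

Let adjH x y : adj H x y = r x y. Proof. exact: adj_mk_graph. Qed.

Let adjC c i j : c \in cop -> adj (copy_graph c) (c i) (c j) = index_adj i j.
Proof.
move=> cP; rewrite adj_mk_graph /copy_adj (inj_eq (cop_inj cP)).
apply/andP/idP => [[_ /existsP[k /existsP[l /and3P[/eqP/(cop_inj cP)-> /eqP/(cop_inj cP)->]]]] //|ij].
split; first by apply: contraTneq ij => ->; rewrite index_adj_irr.
by apply/existsP; exists i; apply/existsP; exists j; rewrite !eqxx.
Qed.

Let adjCP c x y : adj (copy_graph c) x y -> exists i j, [/\ x = c i, y = c j & index_adj i j].
Proof.
rewrite adj_mk_graph => /andP[_ /existsP[i /existsP[j /and3P[/eqP -> /eqP -> ij]]]].
by exists i, j.
Qed.

Let vertsCP c x : x \in verts (copy_graph c) -> exists i, x = c i.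
Proof. by case/imsetP => i _ ->; exists i. Qed.

Let vertsC (c : {ffun 'I_m -> 'I_N}) i : c i \in verts (copy_graph c). Proof. exact: imset_f. Qed.

Lemma copy_graph_induced c : c \in cop -> induced_subgraph (copy_graph c) H.
Proof.
move=> cP; apply/andP; split; first exact: subsetT.
apply/eqP/setP => E; rewrite inE; apply/idP/andP => [EC|[EH sE]].
  split; last exact: edge_sub EC.
  have [x [y [_ -> /adjCP[i [j [-> -> ij]]]]]] := edgeP EC.
  by rewrite -/(adj H _ _) adjH (cs_ind sys cP).
have [x [y [_ eE xy]]] := edgeP EH; move: sE; rewrite eE subUset !sub1set.
move=> /andP[/vertsCP[i xi] /vertsCP[j yj]].
by rewrite -/(adj _ _ _) xi yj adjC // -(cs_ind sys cP) -adjH -xi -yj.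
Qed.

Lemma copy_graph_iso c : c \in cop -> ordered_iso F (copy_graph c).
Proof.
move=> cP; pose rk (x : {x : T | x \in verts F}) : 'I_m := Order.enum_rank_in (valP x) (val x).
have rkK x : vert (rk x) = val x by rewrite /vert Order.enum_rankK_in // (valP x).
pose f (x : {x : T | x \in verts F}) : {y | y \in verts (copy_graph c)} :=
  exist _ (c (rk x)) (vertsC c (rk x)).
exists f; split.
- apply: inj_card_bij => [x y /(congr1 val) /= /(cop_inj cP) e|].
    by apply: val_inj; rewrite -!rkK e.
  rewrite !card_sig; apply: leq_trans (_ : #|verts (copy_graph c)| <= _) => //.
  by rewrite (leq_trans (leq_imset_card _ _)) // cardsT card_ord.
- by move=> x y; rewrite -!rkK le_vert leEord /= cop_mono.
- by move=> x y; rewrite /= adjC // /index_adj !rkK.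
Qed.

Lemma copy_graphs_clean :
  {in copy_graphs &, forall C C', C != C' -> clean_intersection C C'}.
Proof.
move=> _ _ /imsetP[c cP ->] /imsetP[c' cP' ->] ne.
have cc : c != c' by apply: contraNneq ne => ->.
rewrite /clean_intersection; case: leqP => //= /card_gt1P[x [y [xI yI xy]]].
move: (xI) (yI); rewrite !inE => /andP[/vertsCP[i xi] /vertsCP[j xj]].
move=> /andP[/vertsCP[k yk] /vertsCP[l yl]].
have ik : i != k by apply: contraNneq xy => e; rewrite xi yk e.
have jl : j != l by apply: contraNneq xy => e; rewrite xj yl e.
have [Fik two] := cop_clean cP cP' cc ik (etrans (esym xi) xj) (etrans (esym yk) yl).
have cc' : c' != c by rewrite eq_sym.
have [Fjl _] := cop_clean cP' cP cc' jl (etrans (esym xj) xi) (etrans (esym yl) yk).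
have -> : verts (copy_graph c) :&: verts (copy_graph c') = [set x; y].
  apply/setP => z; rewrite inE; apply/andP/set2P => [[/vertsCP[p zp] /vertsCP[q zq]]|].
    by have [e|e] := two p q (etrans (esym zp) zq); [left | right]; rewrite zp e.
  by case=> ->; [rewrite {1}xi xj | rewrite {1}yk yl]; rewrite !vertsC.
rewrite -!/(adj _ _ _); apply/andP; split; first by rewrite xi yk adjC.
by rewrite xj yl adjC.
Qed.

Lemma system_clique_number c : c \in cop -> clique_number H = clique_number F.
Proof.
move=> cP; apply/eqP; rewrite eqn_leq; apply/andP; split.
  apply/bigmax_leqP => K /andP[_ /forall_inP clK]; rewrite cardE; apply: (cs_cliques sys).
  have sub : {subset enum K <= K} by move=> x; rewrite mem_enum.
  elim: (enum K) (enum_uniq K) sub => //= x s IHs /andP[xs us] sub.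
  have sub' : {subset s <= K} by move=> y ys; apply: sub; rewrite inE ys orbT.
  rewrite IHs // andbT; apply/allP => y ys; rewrite -adjH.
  have /forall_inP/(_ y (sub' y ys))/implyP := clK x (sub x (mem_head x s)); apply.
  by apply: contraNneq xs => ->.
apply/bigmax_leqP => K /andP[/subsetP KF /forall_inP clK].
pose I := [set i | vert i \in K].
have eK : K = vert @: I.
  apply/setP => x; apply/idP/imsetP => [xK|[i + ->]]; last by rewrite inE.
  by have [i ei] := vertP (KF x xK); exists i; rewrite // inE -ei.
have <- : #|c @: I| = #|K| by rewrite eK (card_imset _ vert_inj) (card_imset _ (cop_inj cP)).
apply: (@leq_bigmax_cond _ (clique H) (fun K : {set 'I_N} => #|K|)).
apply/andP; split; first exact: subsetT.
apply/forall_inP => _ /imsetP[i iI ->]; apply/forall_inP => _ /imsetP[j jI ->].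
rewrite inE in iI; rewrite inE in jI.
have /forall_inP/(_ _ jI) := clK _ iI; rewrite (inj_eq vert_inj) (inj_eq (cop_inj cP)).
by rewrite adjH (cs_ind sys cP).
Qed.

Lemma system_odd_girth : ele (emin (odd_girth F) (Some (2 * n).+1)) (odd_girth H).
Proof.
case eH: (odd_girth H) => [k|]; last by case: (emin _ _).
have /andP[ok /existsP[s /and3P[_ cs us]]] := least_Some eH.
have [le_k|lt_k] := leqP (2 * n).+1 k.
  rewrite /emin; case: (odd_girth F) => [g|] //=.
  by case: leqP => [le_g|] //=; apply: leq_trans le_g le_k.
have [|||s' [cs' os' le_s']] := cs_odd sys (s := s).
- by move: cs; rewrite (eq_cycle adjH).
- by rewrite size_tuple.
- by rewrite size_tuple doubleS -mul2n; apply: leqW; apply: ltnW.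
have [g -> le_g] := odd_walk_girth cs' os'.
have le_gk : g <= k by rewrite (leq_trans le_g) // (leq_trans le_s') ?size_tuple.
by rewrite /emin /=; case: leqP => [//|lt_g] /=; apply: leq_trans (ltnW lt_g) le_gk.
Qed.

(** The alternative that the path comes from F would put it inside the copy, which is excluded. The
    shorter walk in F is reduced to a path and bounds the distance. *)
Lemma copy_graph_near_induced c : c \in cop -> n_induced n (copy_graph c) H.
Proof.
move=> cP x y p /vertsCP[i ->] /vertsCP[j ->] neq_ij /andP[/and3P[_ pp up] /eqP lp] npC sp.
have [||[s [ps ls lt_s]]|[s [ps es]]] := cs_near sys cP _ lp; last 1 first.
- case/negP: npC; rewrite /is_path vertsC up andbT es /=.
  rewrite path_map; apply: sub_path ps => a b ab /=; by rewrite adjC.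
- by move: pp; rewrite (eq_path adjH).
- by rewrite ltnW.
suff [k ek le_k] : exists2 k, dist (copy_graph c) (c i) (c j) = Some k & k <= size s.
  by rewrite ek /elt /= -ltnNge (leq_ltn_trans le_k).
move: ls; case/shortenP: ps => t pt ut sub lt.
have le_t : size t <= size s by apply: uniq_leq_size sub; case/andP: ut.
have [||k ek le_k] := @least_le #|verts (copy_graph c)|
  (fun k => [exists p : k.-tuple 'I_N, is_path_between (copy_graph c) (c i) (c j) p]) (size t).
- apply/existsP; exists (map_tuple c (in_tuple t)).
  rewrite /is_path_between /is_path vertsC -map_cons (map_inj_uniq (cop_inj cP)) ut andbT /=.
  rewrite last_map lt eqxx andbT path_map; apply: sub_path pt => a b ab /=; by rewrite adjC.
- rewrite (card_imset _ (cop_inj cP)) cardsT; apply: ltnW.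
  by have := max_card (mem (i :: t)); rewrite (card_uniqP ut).
by exists k => //; apply: leq_trans le_k le_t.
Qed.

Lemma copy_graph_canonical c (phi : {set 'I_N} -> nat) : c \in cop ->
  canonical_pattern index_adj (fun i j => phi [set c i; c j]) ->
  canonical_colouring (copy_graph c) phi.
Proof.
move=> cP can.
have edgeE e : e \in edges (copy_graph c) ->
    exists i j : 'I_m, [/\ i < j, index_adj i j & e = [set c i; c j]].
  case/edgeP => [x [y [_ -> /adjCP[i [j [-> -> ij]]]]]].
  case: (ltngtP i j) => [lt_ij|lt_ji|/val_inj e'].
  - by exists i, j.
  - by exists j, i; rewrite index_adj_sym setUC.
  - by rewrite e' index_adj_irr in ij.
have lt_c (i j : 'I_m) : i < j -> (c i < c j)%O by rewrite ltEord; apply: (cs_cop_lev sys cP).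
have minE (i j : 'I_m) : i < j -> set_min [set c i; c j] = Some (c i).
  move=> /lt_c lt_ij; rewrite /set_min; case: pickP => [z /andP[/set2P[] -> // /forall_inP h]|h].
    by have := h (c i) (set21 _ _); rewrite leNgt lt_ij.
  have /negP[] := h (c i); rewrite set21 /=; apply/forall_inP => z /set2P[] -> //; exact: ltW.
have maxE (i j : 'I_m) : i < j -> set_max [set c i; c j] = Some (c j).
  move=> /lt_c lt_ij; rewrite /set_max; case: pickP => [z /andP[/set2P[] -> // /forall_inP h]|h].
    by have := h (c j) (set22 _ _); rewrite leNgt lt_ij.
  have /negP[] := h (c j); rewrite set22 /=; apply/forall_inP => z /set2P[] -> //; exact: ltW.
case: can => h; [constructor 1 | constructor 2 | constructor 3 | constructor 4];
  move=> _ _ /edgeE[i [j [ij Fij ->]]] /edgeE[k [l [kl Fkl ->]]].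
- exact: h.
- rewrite !minE // h //; by split=> [->|[/(cop_inj cP)]].
- rewrite !maxE // h //; by split=> [->|[/(cop_inj cP)]].
- by move=> /h[] // -> ->.
Qed.

End System.
End Conversion.

Theorem theorem2p4 (d : Order.disp_t) (T : finOrderType d) (F : graph T)
    (n : nat) (hn : 1 <= n) :
  exists (d' : Order.disp_t) (U : finOrderType d')
         (H : graph U) (S : {set graph U}),
    [/\ ordered_system F H S,
        n_conform n F H S
      & forall phi : {set U} -> nat,
          exists2 Fstar : graph U,
            Fstar \in S & canonical_colouring Fstar phi].
Proof.
(* An edgeless [F] is its own witness; with an edge, the clique number exceeds 1, as the
   construction requires. *)
have [E0|[e eF]] := set_0Vmem (edges F).
  have iso : ordered_iso F F by exists id; split=> //; exists id.
  have ind : induced_subgraph F F.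
    by rewrite /induced_subgraph subxx E0; apply/eqP/setP => e; rewrite !inE.
  exists d, T, F, [set F]; split.
  - by move=> C /set1P ->.
  - split=> [C C' /set1P -> /set1P ->||| C /set1P ->] //; first by rewrite eqxx.
      by rewrite /emin; case: (odd_girth F) => [g|] //=; case: leqP => //= /ltnW.
    split=> //; first by rewrite /subgraph !subxx.
    by move=> x y p _ _ _ /andP[-> _].
  by move=> phi; exists F; rewrite ?set11 //; constructor 1 => e; rewrite E0 inE.
have w_gt1 : 1 < clique_number F.
  have [x [y [xy ee exy]]] := edgeP eF; rewrite -(edge_card eF).
  apply: (@leq_bigmax_cond _ (clique F) (fun K : {set T} => #|K|)).
  rewrite /clique edge_sub // ee; apply/forall_inP => z /set2P zxy; apply/forall_inP => z' /set2P zxy'.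
  by case: zxy zxy' => -> [] ->; rewrite ?eqxx // ?exy ?implybT // adj_sym exy implybT.
have [N [r [cop [sys [clean ram]]]]] := conform_ramsey_system (@index_adj_sym _ _ F)
  (@index_adj_irr _ _ F) (@index_cliques _ _ F) w_gt1 hn.
have inS c : c \in cop -> copy_graph c \in copy_graphs cop by move=> cP; apply: imset_f.
exists _, 'I_N, (system_graph sys), (copy_graphs cop); split.
- by move=> _ /imsetP[c cP ->]; split; [exact: copy_graph_induced | exact: (copy_graph_iso sys cP)].
(* The Ramsey property for constant colourings provides some copy, so [H] contains the cliques of
   [F]. *)
- have [c cP _] := ram (fun _ _ => 0) (fun _ _ => tt).
  split=> [|||_ /imsetP[c' cP' ->]].
  + exact: copy_graphs_clean sys clean.
  + exact: (system_clique_number sys cP).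
  + exact: system_odd_girth.
  split; last exact: copy_graph_near_induced.
    have /andP[sub /eqP eE] := copy_graph_induced sys cP'.
    by rewrite /subgraph sub eE; apply/subsetP => e'; rewrite inE => /andP[].
  exact: (copy_graph_iso sys cP').
move=> phi; have [c cP [can _]] := ram (fun x y => phi [set x; y]) (fun _ _ => tt).
by exists (copy_graph c); [apply: inS | apply: (copy_graph_canonical sys cP can)].
Qed.
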